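(* Suppose $f:\mathbb{R}^d\to\mathbb{R}$ is continuously differentiable with $L$-Lipschitz continuous gradient, and let $f^*=\min_{x\in\mathbb{R}^d}f(x)$. Let $\epsilon>0$, $\delta_S^{(2)}>0$, $\epsilon_S\in(0,1)$, $\delta_1>0$ and $l\in\mathbb{N}^+$ be such that $$\delta_S<\frac{c}{(c+1)^2},\qquad\left[(1-\delta_S)(1-\delta_1)-1+\frac{c}{(c+1)^2}\right]^{-1}>0,$$ where $\delta_S=e^{-l\epsilon_S^2/4}+\delta_S^{(2)}$. Run the random subspace quadratic regularisation algorithm of the context, with $\mathcal{S}$ the distribution of scaled Gaussian matrices in $\mathbb{R}^{l\times d}$, for $N$ iterations with $$N\ge\left[(1-\delta_S)(1-\delta_1)-1+\frac{c}{(c+1)^2}\right]^{-1}\left[\frac{f(x_0)-f^*}{h(\epsilon,\alpha_0\gamma_1^{c+\tau_\alpha})}+\frac{\tau_\alpha}{1+c}\right],$$ where $$h(\epsilon,\alpha_0\gamma_1^{c+\tau_\alpha})=\frac{\theta(1-\epsilon_S)\epsilon^2}{2\alpha_{\max}\left(\left[1+\sqrt{\frac dl}+\sqrt{\frac{2\log(1/\delta_S^{(2)})}{l}}\right]\left(B_{max}+\alpha_0^{-1}\gamma_1^{-c-\tau_\alpha}\right)+\kappa_T\right)^2},$$ $$\tau_\alpha=\left\lceil\log_{\gamma_1}\left(\min\left\{\frac{\alpha_{low}}{\alpha_0},\frac1{\gamma_2}\right\}\right)\right\rceil,\qquad\alpha_{low}=\frac{1-\theta}{L+B_{max}}.$$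 Then $$\mathbb{P}(N\ge N_\epsilon)\ge1-e^{-\frac{\delta_1^2}{2}(1-\delta_S)N},\qquad\text{where }N_\epsilon=\min\{k:\|\nabla f(x_k)\|_2\le\epsilon\}.$$
   Context: Scaled Gaussian matrix: $S\in\mathbb{R}^{l\times d}$ with independent $N(0,1/l)$ entries. Random subspace quadratic regularisation algorithm. Parameters: a distribution $\mathcal{S}$ of matrices in $\mathbb{R}^{l\times d}$ ($l\le d$), $\gamma_1\in(0,1)$, $\gamma_2=\gamma_1^{-c}$ for some $c\in\mathbb{N}^+$, $\theta\in(0,1)$, $\alpha_{\max},B_{max}>0$, $\kappa_T\ge0$, deterministic $x_0\in\mathbb{R}^d$, $\alpha_0=\alpha_{\max}\gamma_1^p$ for some $p\in\mathbb{N}^+$. At each iteration $k=0,1,\dots$: 1. Draw $S_k$ from $\mathcal{S}$, independently of all previous iterations. Let $\hat m_k(\hat s)=f(x_k)+\langle S_k\nabla f(x_k),\hat s\rangle+\frac12\langle\hat s,S_kB_kS_k^T\hat s\rangle$ for $\hat s\in\mathbb{R}^l$, where $B_k\in\mathbb{R}^{d\times d}$ is a user-provided (symmetric) positive semi-definite matrix with $\|B_k\|_2\le B_{max}$. With $\hat l_k(\hat s)=\hat m_k(\hat s)+\frac1{2\alpha_k}\|S_k^T\hat s\|_2^2$, compute $\hat s_k$ such that $\|\nabla\hat l_k(\hat s_k)\|_2\le\kappa_T\|S_k^T\hat s_k\|_2$ and $\hat l_k(\hat s_k)\le\hat l_k(0)$, and set $s_k=S_k^T\hat s_k$. 2. Sufficient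 decrease test: $f(x_k)-f(x_k+s_k)\ge\theta[\hat m_k(0)-\hat m_k(\hat s_k)]$. 3. If the test holds, set $x_{k+1}=x_k+s_k$, $\alpha_{k+1}=\min\{\alpha_{\max},\gamma_2\alpha_k\}$; otherwise $x_{k+1}=x_k$, $\alpha_{k+1}=\gamma_1\alpha_k$. *)

(* Defs.v *)
From HB Require Import structures.
From mathcomp Require Import all_boot all_order all_algebra.
From mathcomp Require Import all_classical all_reals all_analysis.

Set Implicit Arguments.
Unset Strict Implicit.
Unset Printing Implicit Defensive.

Import Order.TTheory GRing.Theory Num.Theory.
Import numFieldNormedType.Exports.

Local Open Scope classical_set_scope.
Local Open Scope ring_scope.

Section Euclidean.
Variable R : realType.

Definition dotv n (u v : 'cV[R]_n) : R := (u^T *m v) 0 0.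

(* The library norm on matrices is the max-norm; the algorithm uses the
   Euclidean one. *)
Definition norm2 n (v : 'cV[R]_n) : R := Num.sqrt (dotv v v).

Definition opnorm2 m n (A : 'M[R]_(m, n)) : R :=
  sup [set norm2 (A *m v) | v in [set v : 'cV[R]_n | norm2 v <= 1]].

Definition psd n (B : 'M[R]_n) : Prop :=
  B^T = B /\ forall v : 'cV[R]_n, 0 <= dotv v (B *m v).

Definition grad n (f : 'cV[R]_n -> R) (x : 'cV[R]_n) : 'cV[R]_n :=
  \col_i 'D_(delta_mx i 0) f x.

Definition continuously_differentiable n (f : 'cV[R]_n -> R) : Prop :=
  (forall x, differentiable f x) /\ continuous (grad f).

Definition lipschitz_grad n (L : R) (f : 'cV[R]_n -> R) : Prop :=
  forall x y, norm2 (grad f x - grad f y) <= L * norm2 (x - y).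

End Euclidean.

Section RandomMatrices.
Context {disp : measure_display} {T : measurableType disp} {R : realType}.
Variable P : probability T R.

(* A random matrix is a matrix of real random variables. *)
Definition mxval m n (X : 'M[{RV P >-> R}]_(m, n)) (w : T) : 'M[R]_(m, n) :=
  \matrix_(i, j) X i j w.

Definition mutually_independent (I : finType) (X : I -> {RV P >-> R}) : Prop :=
  forall (J : {set I}) (A : I -> set R), (forall i, measurable (A i)) ->
  P (\bigcap_(i in [set` J]) (X i @^-1` A i))
    = (\prod_(i in J) P (X i @^-1` A i))%E.

Definition scaled_gaussian l d (S : 'M[{RV P >-> R}]_(l, d)) : Prop :=
  mutually_independent (fun ij : 'I_l * 'I_d => S ij.1 ij.2) /\
  forall i j A, measurable A ->
    distribution P (S i j) A = normal_prob 0 (Num.sqrt (l%:R^-1)) A.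

Definition entry_events m n (X : 'M[{RV P >-> R}]_(m, n)) : set (set T) :=
  \bigcup_(ij in [set: 'I_m * 'I_n])
    preimage_set_system setT (X ij.1 ij.2) measurable.

Definition independent_systems (F G : set (set T)) : Prop :=
  forall A B, F A -> G B -> P (A `&` B) = (P A * P B)%E.

(* sigma-algebra of everything drawn or chosen in iterations 0, ..., k-1; the
   iterates x_0, ..., x_k and alpha_0, ..., alpha_k are functions of these. *)
Definition history l d (S : nat -> 'M[{RV P >-> R}]_(l, d))
    (B : nat -> 'M[{RV P >-> R}]_d) (shat : nat -> 'cV[{RV P >-> R}]_l)
    (k : nat) : set (set T) :=
  <<s \bigcup_(i in [set i | (i < k)%N])
        (entry_events (S i) `|` entry_events (B i) `|`
         entry_events (shat i)) >>.

End RandomMatrices.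

Section Algorithm.
Variables (R : realType) (l d : nat).

Definition mhat (f : 'cV[R]_d -> R) (x : 'cV[R]_d) (S : 'M[R]_(l, d))
    (B : 'M[R]_d) (s : 'cV[R]_l) : R :=
  f x + dotv (S *m grad f x) s + 2^-1 * dotv s (S *m B *m S^T *m s).

Definition lhat (f : 'cV[R]_d -> R) (x : 'cV[R]_d) (S : 'M[R]_(l, d))
    (B : 'M[R]_d) (alpha : R) (s : 'cV[R]_l) : R :=
  mhat f x S B s + (2 * alpha)^-1 * norm2 (S^T *m s) ^+ 2.

(* The first N iterations of the random subspace quadratic regularisation
   algorithm; the law of the sketching matrices S_k is left open. *)
Record rsqr_run {disp : measure_display} {T : measurableType disp}
    (P : probability T R) (f : 'cV[R]_d -> R)
    (gamma1 gamma2 theta alpha_max alpha0 Bmax kappaT : R) (x0 : 'cV[R]_d)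
    (N : nat) (S : nat -> 'M[{RV P >-> R}]_(l, d))
    (B : nat -> 'M[{RV P >-> R}]_d) (shat : nat -> 'cV[{RV P >-> R}]_l)
    (x : nat -> T -> 'cV[R]_d) (alpha : nat -> T -> R) : Prop := {
  run_x0 : forall w, x 0%N w = x0;
  run_alpha0 : forall w, alpha 0%N w = alpha0;
  run_draw : forall k, (k < N)%N ->
    independent_systems P <<s entry_events (S k) >> (history S B shat k);
  run_B : forall k w, (k < N)%N ->
    psd (mxval (B k) w) /\ opnorm2 (mxval (B k) w) <= Bmax;
  run_grad : forall k w, (k < N)%N ->
    norm2 (grad (lhat f (x k w) (mxval (S k) w) (mxval (B k) w) (alpha k w))
                (mxval (shat k) w))
      <= kappaT * norm2 ((mxval (S k) w)^T *m mxval (shat k) w);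
  run_decrease : forall k w, (k < N)%N ->
    lhat f (x k w) (mxval (S k) w) (mxval (B k) w) (alpha k w)
         (mxval (shat k) w)
      <= lhat f (x k w) (mxval (S k) w) (mxval (B k) w) (alpha k w) 0;
  run_update : forall k w, (k < N)%N ->
    let s := (mxval (S k) w)^T *m mxval (shat k) w in
    let m := mhat f (x k w) (mxval (S k) w) (mxval (B k) w) in
    if theta * (m 0 - m (mxval (shat k) w)) <= f (x k w) - f (x k w + s)
    then x k.+1 w = x k w + s /\
         alpha k.+1 w = Num.min alpha_max (gamma2 * alpha k w)
    else x k.+1 w = x k w /\ alpha k.+1 w = gamma1 * alpha k w
}.

(* min {k : ||grad f (x_k)|| <= eps}, equal to +oo when there is no such k.
   For a run of N iterations, only x_0, ..., x_N decide whether it is <= N. *)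
Definition N_eps (T : Type) (f : 'cV[R]_d -> R) (x : nat -> T -> 'cV[R]_d)
    (eps : R) (w : T) : \bar R :=
  ereal_inf [set (k%:R)%:E | k in [set k : nat | norm2 (grad f (x k w)) <= eps]].

End Algorithm.

Definition log_base (R : realType) (b y : R) : R := ln y / ln b.

(* Main.v *)
(* An iteration is good when the sketch S and the gradient g satisfy
   |S g|^2 >= (1 - epsS) |g|^2 and |S^T S g| <= Smax |S g|.  No bound on the
   operator norm of S is needed: testing the residual
   S g + S (B + 1/alpha) s, of norm at most kappaT |s|, against u = S g / |S g|
   gives |S g| <= (|S^T u| (Bmax + 1/alpha) + kappaT) |s|.  By rotation
   invariance of Gaussian matrices, l |S g|^2 / |g|^2 and l |S^T u|^2 are
   chi-square variables with l and l + d - 1 degrees of freedom, and Chernoff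
   bounds show that an iteration is bad with conditional probability at most
   deltaS given the past; hence the number of good iterations exceeds
   (1 - delta1) (1 - deltaS) N outside an event of the stated probability.
   On a run, alpha_k never drops below alpha0 gamma1^tau, since smaller steps are
   always successful; so at least (N - tau) / (1 + c) iterations are successful,
   and each good successful one decreases f by h while |grad f| > eps. If this
   goes on for N iterations then x_N minimises f, a contradiction. *)
From HB Require Import structures.
Require Import Defs.
From mathcomp Require Import all_boot all_order all_algebra.
From mathcomp Require Import all_classical all_reals all_analysis.
From mathcomp Require Import measurable_realfun.
From mathcomp Require Import zify ring lra.

Set Implicit Arguments.
Unset Strict Implicit.
Unset Printing Implicit Defensive.

Import Order.TTheory GRing.Theory Num.Theory.
Import numFieldNormedType.Exports.

Local Open Scope classical_set_scope.
Local Open Scope ring_scope.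

(** * Independence and the law of Gaussian families *)

(** Two obstacles shape the proof. The direction [u] in which [S^T] is tested depends on [S], and
    the gradient at iteration k depends on the past, whereas rotation invariance is available for
    fixed vectors only. Both are met by one device: the integral of [F (w, w)] over independent
    sigma-algebras equals the iterated integral of [F (w1, w2)], so that the first argument can be
    frozen. No conditional expectation appears: a bound given the past means
    [P (bad & H) <= q * P H] for every past event [H]. Rotation invariance is reduced to
    translations of the line. A plane rotation is a product of shears, each a translation inside an
    iterated integral; a rotation taking [g] to the first axis is a product of plane rotations of
    pairs of columns. Finite families are described by product formulas on rectangles, so no
    Lebesgue measure above dimension two is involved. *)

Section DecouplingSec.
Context d d1 d2 (T : measurableType d) (T1 : measurableType d1)
  (T2 : measurableType d2) (R : realType) (P : probability T R).
Local Open Scope ereal_scope.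

(** Independence on rectangles identifies the joint law with the product of the two laws; the rest
    is Tonelli. *)
Lemma ge0_integral_independent (X : {RV P >-> T1}) (Y : {RV P >-> T2})
    (F : T1 * T2 -> \bar R) :
  (forall A B, measurable A -> measurable B ->
    P (X @^-1` A `&` Y @^-1` B) = P (X @^-1` A) * P (Y @^-1` B)) ->
  measurable_fun setT F -> (forall z, 0 <= F z) ->
  \int[P]_w F (X w, Y w) = \int[P]_w1 \int[P]_w2 F (X w1, Y w2).
Proof.
move=> indep mF F0.
have mXY : measurable_fun setT (fun w => (X w, Y w)).
  exact: measurable_fun_pair.
pose XY : {mfun T >-> (T1 * T2)%type} := HB.pack (fun w => (X w, Y w))
  (isMeasurableFun.Build _ _ _ _ _ mXY).
have -> : \int[P]_w F (X w, Y w) = \int[distribution P XY]_z F z.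
  by rewrite (@ge0_integral_distribution _ _ _ _ _ P XY F).
have -> : \int[distribution P XY]_z F z
    = \int[distribution P X \x distribution P Y]_z F z.
  apply: eq_measure_integral => A mA _.
  by apply/esym/product_measure_unique => // B C mB mC; rewrite -indep.
rewrite fubini_tonelli1// (@ge0_integral_distribution _ _ _ _ _ P X)//.
- apply: eq_integral => w1 _ /=; rewrite /fubini_F.
  rewrite (@ge0_integral_distribution _ _ _ _ _ P Y)//.
  exact: measurableT_comp.
- exact: measurable_fun_fubini_tonelli_F.
- by move=> x; apply: integral_ge0.
Qed.

End DecouplingSec.

Section SubSigma.
Context d (T : measurableType d) (R : realType) (P : probability T R).
Local Open Scope ereal_scope.

Lemma measurable_id_g_sigma (G : set (set T)) :
  <<s G >> `<=` measurable ->
  measurable_fun setT (id : T -> g_sigma_algebraType G).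
Proof. by move=> sG _ A /sG mA; rewrite setTI. Qed.

(** The two independent variables are both the identity of [T], with values in [T] under the
    sigma-algebras generated by [G] and [H]. This splits the diagonal into two copies of the
    outcome. *)
Lemma ge0_integral_independent_systems (G H : set (set T))
    (F : g_sigma_algebraType G * g_sigma_algebraType H -> \bar R) :
  <<s G >> `<=` measurable -> <<s H >> `<=` measurable ->
  independent_systems P <<s G >> <<s H >> ->
  measurable_fun [set: g_sigma_algebraType G * g_sigma_algebraType H] F ->
  (forall z, 0 <= F z) ->
  \int[P]_w F (w, w) = \int[P]_w1 \int[P]_w2 F (w1, w2).
Proof.
move=> sG sH GH mF F0.
pose X : {mfun T >-> g_sigma_algebraType G} :=
  HB.pack (id : T -> g_sigma_algebraType G)
  (isMeasurableFun.Build _ _ _ _ _ (measurable_id_g_sigma sG)).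
pose Y : {mfun T >-> g_sigma_algebraType H} :=
  HB.pack (id : T -> g_sigma_algebraType H)
  (isMeasurableFun.Build _ _ _ _ _ (measurable_id_g_sigma sH)).
exact: (@ge0_integral_independent _ _ _ _ _ _ _ P X Y).
Qed.

End SubSigma.

(** * Rotation invariance on the plane *)

Section PlanarRotation.
Context (R : realType).
Local Notation mu := (@lebesgue_measure R).
Local Open Scope ereal_scope.

Lemma lebesgue_measure_shift (a : R) (A : set (measurableTypeR R)) :
  measurable A ->
  pushforward mu ((fun x => x + a)%R : measurableTypeR R -> measurableTypeR R) A
    = mu A.
Proof.
have ms : measurable_fun setT
  ((fun x => x + a)%R : measurableTypeR R -> measurableTypeR R).
  exact: measurable_funD.
pose X : {mfun measurableTypeR R >-> measurableTypeR R} :=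
  HB.pack ((fun x => x + a)%R : measurableTypeR R -> measurableTypeR R)
    (isMeasurableFun.Build _ _ _ _ _ ms).
move=> mA; apply/esym.
apply: (@lebesgue_measure_unique R (pushforward mu X)) => //= _ [[b c]] _ <-.
rewrite /pushforward/=.
have -> : ((fun x => x + a)%R @^-1` `]b, c]%classic) =
    `](b - a)%R, (c - a)%R]%classic :> set R.
  by apply/seteqP; split => x /=; rewrite !in_itv/= ltrBlDr lerBrDr.
rewrite !lebesgue_measure_itv/= !lte_fin ltrD2r.
by case: ifP => // _; rewrite -!EFinD; congr (_%:E); rewrite opprB addrA subrK.
Qed.

Lemma ge0_integral_shift (a : R) (f : R -> \bar R) :
  measurable_fun setT f -> (forall x, 0 <= f x) ->
  \int[mu]_x f (x + a)%R = \int[mu]_x f x.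
Proof.
move=> mf f0.
have ms : measurable_fun setT
  ((fun x => x + a)%R : measurableTypeR R -> measurableTypeR R).
  exact: measurable_funD.
transitivity (\int[pushforward mu ((fun x => x + a)%R :
    measurableTypeR R -> measurableTypeR R)]_x f x).
  by rewrite ge0_integral_pushforward.
pose X : {mfun measurableTypeR R >-> measurableTypeR R} :=
  HB.pack ((fun x => x + a)%R : measurableTypeR R -> measurableTypeR R)
    (isMeasurableFun.Build _ _ _ _ _ ms).
apply: (@eq_measure_integral _ _ _ _ mu (pushforward mu X)) => A mA _.
exact: lebesgue_measure_shift.
Qed.

Definition plane_integral (F : R * R -> \bar R) :=
  \int[mu]_x \int[mu]_y F (x, y).

(** Tonelli makes the first coordinate the inner one; at a fixed second coordinate the shear is a
    translation. *)
Lemma plane_integral_shear1 (a : R) (F : R * R -> \bar R) :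
  measurable_fun setT F -> (forall z, 0 <= F z) ->
  plane_integral (fun z => F (z.1 + a * z.2, z.2)%R) = plane_integral F.
Proof.
move=> mF F0; rewrite /plane_integral.
have mF1 : measurable_fun setT (fun z : R * R => F (z.1 + a * z.2, z.2)%R).
  apply: measurableT_comp => //; apply: measurable_fun_pair => //.
  by apply: measurable_funD => //; exact: measurable_funM.
have h := @fubini_tonelli _ _ _ _ _ mu mu _ mF1 (fun z => F0 _).
have h' := @fubini_tonelli _ _ _ _ _ mu mu _ mF F0.
rewrite /fubini_F/= /fubini_G/= in h h'.
rewrite h h'; apply: eq_integral => y _.
apply: (ge0_integral_shift (a * y)%R (f := fun x => F (x, y))) => //.
exact: measurableT_comp.
Qed.

Lemma plane_integral_shear2 (a : R) (F : R * R -> \bar R) :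
  measurable_fun setT F -> (forall z, 0 <= F z) ->
  plane_integral (fun z => F (z.1, z.2 + a * z.1)%R) = plane_integral F.
Proof.
move=> mF F0; rewrite /plane_integral.
apply: eq_integral => x _ /=.
apply: (ge0_integral_shift (a * x)%R (f := fun y => F (x, y))) => //.
exact: measurableT_comp.
Qed.

(* A rotation by an angle t is a composition of three shears, with
   coefficients - tan (t / 2), sin t and - tan (t / 2). *)
Lemma plane_integral_rot (c s : R) (F : R * R -> \bar R) :
  (c ^+ 2 + s ^+ 2 = 1)%R -> s != 0%R ->
  measurable_fun setT F -> (forall z, 0 <= F z) ->
  plane_integral (fun z => F (c * z.1 + s * z.2, c * z.2 - s * z.1)%R)
    = plane_integral F.
Proof.
move=> cs1 s0 mF F0; pose a : R := ((1 - c) / s)%R.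
have m1 : measurable_fun setT (fun z : R * R => (z.1 + a * z.2, z.2)%R).
  apply: measurable_fun_pair => //.
  by apply: measurable_funD => //; exact: measurable_funM.
have m2 : measurable_fun setT (fun z : R * R => (z.1, z.2 + (- s) * z.1)%R).
  apply: measurable_fun_pair => //.
  by apply: measurable_funD => //; exact: measurable_funM.
rewrite -[RHS](plane_integral_shear1 a mF F0).
set G := (X in _ = plane_integral X).
have mG : measurable_fun setT G by exact: measurableT_comp mF m1.
have G0 z : 0 <= G z by exact: F0.
rewrite -[RHS](plane_integral_shear2 (- s)%R mG G0).
have mG2 := measurableT_comp mG m2.
rewrite -[RHS](plane_integral_shear1 a mG2); last by move=> z; exact: F0.
congr plane_integral; apply/funext => -[x y]; rewrite /G/=.
have as1 : (a * s = 1 - c)%R by rewrite /a divfK.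
have ac : (a * (1 + c) = s)%R.
  apply: (mulIf s0); rewrite mulrAC as1 -subr_sqr expr1n -cs1.
  by rewrite addrC addKr expr2.
congr (F (_, _)).
  transitivity ((1 - a * s) * x + (a * (1 + (1 - a * s))) * y)%R; last by ring.
  by rewrite as1 subKr ac.
transitivity ((1 - a * s) * y - s * x)%R; last by ring.
by rewrite as1 subKr.
Qed.

End PlanarRotation.

(** * Densities and the Gaussian measure *)

Section DensitySec.
Context d (T : measurableType d) (R : realType).
Variables (mu nu : {measure set T -> \bar R}) (p : T -> R).
Hypothesis mp : measurable_fun setT p.
Hypothesis p0 : forall x, 0 <= p x.
Hypothesis nuE : forall A, measurable A ->
  nu A = (\int[mu]_(x in A) (p x)%:E)%E.
Local Open Scope ereal_scope.
Import HBNNSimple.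

Let mpE : measurable_fun setT (EFin \o p).
Proof. exact/measurable_EFinP. Qed.

Let integral_density_nnsfun (f : {nnsfun T >-> R}) :
  \int[nu]_x (f x)%:E = \int[mu]_x ((f x)%:E * (p x)%:E).
Proof.
under [LHS]eq_integral do rewrite fimfunE -fsumEFin//.
rewrite [LHS]ge0_integral_fsum//; last 2 first.
  - by move=> r; exact/measurable_EFinP/measurableT_comp.
  - by move=> n x _; rewrite EFinM nnfun_muleindic_ge0.
under [RHS]eq_integral.
  move=> x xD; rewrite fimfunE -fsumEFin// muleC ge0_mule_fsumr; last first.
    by move=> r; rewrite EFinM nnfun_muleindic_ge0.
  over.
rewrite [RHS]ge0_integral_fsum//; last 2 first.
  - move=> r; apply: emeasurable_funM => //.
    by apply/measurable_EFinP; apply/measurableT_comp.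
  - move=> n x _; rewrite EFinM mule_ge0//; last by rewrite nnfun_muleindic_ge0.
    by rewrite lee_fin.
apply: eq_fsbigr => r _; rewrite integralZl_indic_nnsfun//=.
under [RHS]eq_integral do rewrite EFinM muleCA.
have [r0|r0] := leP 0%R r; last first.
  rewrite [in LHS]preimage_nnfun0// integral_indic//= set0I measure0 mule0.
  rewrite integral0_eq// => x _.
  by rewrite preimage_nnfun0// indic0/= !mule0.
rewrite ge0_integralZl//; last 2 first.
- apply: emeasurable_funM => //; apply/measurable_EFinP; exact: measurable_indic.
- by move=> x _; rewrite mule_ge0// lee_fin.
congr (_ * _); rewrite integral_indic//= setIT nuE// integral_mkcond/=.
apply: eq_integral => x _; rewrite patchE indicE.
by case: ifPn => _; rewrite ?mule1 ?mule0.
Qed.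

(** For indicators this is [nuE]; linearity gives simple functions, and monotone convergence the
    general case. *)
Lemma ge0_integral_density (f : T -> \bar R) :
  measurable_fun setT f -> (forall x, 0 <= f x) ->
  \int[nu]_x f x = \int[mu]_x (f x * (p x)%:E).
Proof.
move=> mf f0.
pose f_ := nnsfun_approx measurableT mf.
have cf x : (f_ n x)%:E @[n --> \oo] --> f x.
  by apply: cvg_nnsfun_approx => // y _.
transitivity (limn (fun n => \int[nu]_x (f_ n x)%:E)).
  rewrite -monotone_convergence//=.
  - by apply: eq_integral => x _; apply/esym/cvg_lim => //; exact: cf.
  - by move=> n; exact/measurable_EFinP/measurable_funTS.
  - by move=> n ? _; rewrite lee_fin.
  - by move=> ? _ ? ? mn; rewrite lee_fin; exact/lefP/nd_nnsfun_approx.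
rewrite (_ : (fun n => _) = (fun n => \int[mu]_x ((f_ n x)%:E * (p x)%:E))).
  rewrite -monotone_convergence//=.
  - apply: eq_integral => x _; apply/cvg_lim => //.
    by under eq_fun do rewrite muleC; rewrite muleC; apply: cvgeZl => //; exact: cf.
  - by move=> n; apply: emeasurable_funM => //; exact/measurable_EFinP/measurable_funTS.
  - by move=> n ? _; rewrite mule_ge0// lee_fin.
  - move=> x _ ? ? mn; rewrite lee_wpmul2r ?lee_fin//.
    exact/lefP/nd_nnsfun_approx.
by apply/funext => n; exact: integral_density_nnsfun.
Qed.

End DensitySec.

Lemma ge0_integral_normal_prob (R : realType) (m s : R) (f : R -> \bar R) :
  measurable_fun setT f -> (forall x, 0 <= f x)%E ->
  (\int[normal_prob m s]_x f x
    = \int[lebesgue_measure]_x (f x * (normal_pdf m s x)%:E))%E.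
Proof.
move=> mf f0; apply: ge0_integral_density => //.
- exact: measurable_normal_pdf.
- exact: normal_pdf_ge0.
Qed.

Section CenteredNormal.
Context (R : realType) (s : R).

Let mid : measurable_fun setT (id : measurableTypeR R -> R).
Proof. exact: measurable_id. Qed.

Let idR : {mfun measurableTypeR R >-> R} :=
  HB.pack (id : measurableTypeR R -> R) (isMeasurableFun.Build _ _ _ _ _ mid).

(* [normal_prob] lives on [measurableTypeR R]; this is the same measure on the
   canonical measurable space [R]. *)
Definition gaussian : probability R R :=
  distribution (normal_prob 0 s) idR.

Lemma gaussianE A : gaussian A = normal_prob 0 s A.
Proof. by []. Qed.

Lemma ge0_integral_gaussian (f : R -> \bar R) :
  measurable_fun setT f -> (forall x, 0 <= f x)%E ->
  (\int[gaussian]_x f x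
    = \int[lebesgue_measure]_x (f x * (normal_pdf 0 s x)%:E))%E.
Proof.
move=> mf f0; rewrite -ge0_integral_normal_prob//.
by rewrite /gaussian ge0_integral_distribution.
Qed.
End CenteredNormal.

Section NormalRotation.
Context (R : realType) (s : R).
Hypothesis s0 : s != 0.
Local Notation gam := (gaussian s).
Local Notation pdf := (normal_pdf 0 s).
Local Open Scope ereal_scope.

Lemma product_gaussianE (C : set (R * R)) : measurable C ->
  (gam \x gam) C =
  plane_integral (fun z => (\1_C z * (pdf z.1 * pdf z.2))%:E).
Proof.
move=> mC; have mi : measurable_fun setT (fun z : R * R => (\1_C z)%:E : \bar R).
  by apply/measurable_EFinP; exact: measurable_indic.
transitivity (\int[gam \x gam]_z (\1_C z)%:E).
  by rewrite (integral_indic _ measurableT mC) setIT.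
rewrite fubini_tonelli1//.
rewrite ge0_integral_gaussian; last 2 first.
- by apply: measurable_fun_fubini_tonelli_F => // x; rewrite lee_fin.
- by move=> x; apply: integral_ge0 => y _; rewrite lee_fin.
apply: eq_integral => x _; rewrite /fubini_F.
have mix : measurable_fun setT (fun y : R => (\1_C (x, y))%:E : \bar R).
  exact: (measurable_fun_pair2 _ mi).
rewrite ge0_integral_gaussian//.
rewrite -ge0_integralZr//.
- by apply: eq_integral => y _; rewrite -!EFinM -mulrA (mulrC (pdf y)).
- apply: emeasurable_funM => //; apply/measurable_EFinP.
  exact: measurable_normal_pdf.
- by move=> y _; rewrite mule_ge0// lee_fin// normal_pdf_ge0.
- by rewrite lee_fin normal_pdf_ge0.
Qed.

(** The product of the two densities depends only on [z.1 ^+ 2 + z.2 ^+ 2], so the invariance of the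
    plane integral passes to the Gaussian measure. The conclusion says that the rotated coordinates
    are again independent Gaussians. *)
Lemma product_gaussian_rot (c t : R) (A B : set R) :
  (c ^+ 2 + t ^+ 2 = 1)%R -> t != 0%R -> measurable A -> measurable B ->
  (gam \x gam) [set z | A (c * z.1 + t * z.2)%R /\ B (c * z.2 - t * z.1)%R] =
  gam A * gam B.
Proof.
move=> ct1 t0 mA mB; rewrite -(product_measure1E _ _ mA mB).
set C := [set z | _].
have mAB : measurable (A `*` B) := measurableX mA mB.
have mrot : measurable_fun setT
    (fun z : R * R => (c * z.1 + t * z.2, c * z.2 - t * z.1)%R).
  apply: measurable_fun_pair => //.
    by apply: measurable_funD => //; exact: measurable_funM.
  by apply: measurable_funB => //; exact: measurable_funM.
have mC : measurable C.
  by rewrite -[C]setTI; exact: (mrot measurableT _ mAB).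
rewrite (product_gaussianE mC) (product_gaussianE mAB).
rewrite -[RHS](plane_integral_rot ct1 t0); last 2 first.
- apply/measurable_EFinP; apply: measurable_funM => //.
  apply: measurable_funM => //; apply: measurableT_comp => //;
    exact: measurable_normal_pdf.
- by move=> z; rewrite lee_fin mulr_ge0// mulr_ge0// normal_pdf_ge0.
congr plane_integral; apply/funext => -[x y] /=; congr ((_ * _)%R%:E).
rewrite normal_pdfE// mulrACA [RHS]mulrACA; congr (_ * _)%R.
rewrite /normal_fun -!expRD; congr expR; rewrite !subr0 -!mulrDl -!opprD.
congr (- _ / _)%R; rewrite -[LHS]mul1r -ct1; ring.
Qed.

End NormalRotation.

(** * Finite iid families *)

Section IidFamilies.
Context d (T : measurableType d) (R : realType) (P : probability T R).
Variable g : set R -> \bar R.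
Local Open Scope ereal_scope.

(** When [g] has total mass 1, one product over all of [I] carries both the common law and the
    independence: subfamilies are obtained by taking [setT] at the other indices. *)
Definition iid (I : finType) (Z : I -> T -> R) : Prop :=
  (forall i, measurable_fun setT (Z i)) /\
  forall A : I -> set R, (forall i, measurable (A i)) ->
    P [set w | forall i, A i (Z i w)] = \prod_i g (A i).

End IidFamilies.

Lemma measurable_forall_fin d (T : measurableType d) (I : finType)
    (A : I -> set T) :
  (forall i, measurable (A i)) -> measurable [set w | forall i, A i w].
Proof.
move=> mA; have -> : [set w | forall i, A i w] = \bigcap_(i in [set: I]) A i.
  by apply/seteqP; split=> [w h i _|w h i]; [exact: h|exact: (h i)].
by apply: fin_bigcap_measurable => //; exact: finite_finset.
Qed.

Lemma measurable_comp_preimage d d' (T : measurableType d)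
    (T' : measurableType d') (f : T -> T') (A : set T') :
  measurable_fun setT f -> measurable A -> measurable [set w | A (f w)].
Proof. by move=> mf mA; rewrite -[X in measurable X]setTI; exact: mf. Qed.

Lemma measure_rectangles_eq d1 d2 (T1 : measurableType d1)
    (T2 : measurableType d2) (R : realType)
    (m1 m2 : {measure set (T1 * T2) -> \bar R}) :
  (m1 setT < +oo)%E ->
  (forall A B, measurable A -> measurable B ->
    m1 (A `*` B) = m2 (A `*` B)) ->
  forall C, measurable C -> m1 C = m2 C.
Proof.
move=> fin mE C mC.
apply: (measure_unique [set A `*` B | A in measurable & B in measurable]
  (fun=> setT)) => //.
- by rewrite measurable_prod_measurableType.
- move=> _ _ [A mA [B mB <-]] [A' mA' [B' mB' <-]].
  exists (A `&` A'); first exact: measurableI.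
  by exists (B `&` B'); [exact: measurableI|rewrite setXI].
- by move=> _; exists setT => //; exists setT => //; rewrite setXTT.
- by rewrite bigcup_const.
- by move=> _ [A mA [B mB <-]]; exact: mE.
Qed.

Section GivensIid.
Context d (T : measurableType d) (R : realType) (P : probability T R) (s : R).
Hypothesis s0 : s != 0.
Local Notation gam := (gaussian s).
Local Open Scope ereal_scope.

(** Fix the event [E] on the coordinates other than [a] and [b]. Restricted to [E], the law of the
    pair [(Z a, Z b)] is a constant multiple of the product Gaussian, to which the plane rotation
    applies. *)
Lemma iid_givens (I : finType) (Z : I -> T -> R) (a b : I) (c t : R) :
  iid P gam Z -> a != b -> (c ^+ 2 + t ^+ 2 = 1)%R -> t != 0%R ->
  iid P gam (fun i w => if i == a then (c * Z a w + t * Z b w)%R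
                        else if i == b then (c * Z b w - t * Z a w)%R
                        else Z i w).
Proof.
move=> [mZ PZ] ab ct1 t0; split=> [i|A mA].
  case: (i == a); first by apply: measurable_funD; exact: measurable_funM.
  by case: (i == b) => //; apply: measurable_funB; exact: measurable_funM.
pose E := [set w | forall i, i != a -> i != b -> A i (Z i w)].
have mE : measurable E.
  apply: measurable_forall_fin => i.
  have [->|ia] := eqVneq i a; first by rewrite [X in measurable X](_ : _ = setT)//;
    apply/seteqP; split.
  have [->|ib] := eqVneq i b; first by rewrite [X in measurable X](_ : _ = setT)//;
    apply/seteqP; split.
  rewrite [X in measurable X](_ : _ = [set w | A i (Z i w)]).
    exact: measurable_comp_preimage.
  by apply/seteqP; split => w /= h //; exact: h.
have mZZ : measurable_fun setT (fun w => (Z a w, Z b w)).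
  exact: measurable_fun_pair.
pose ZZ : {mfun T >-> (R * R)%type} := HB.pack (fun w => (Z a w, Z b w))
  (isMeasurableFun.Build _ _ _ _ _ mZZ).
pose k : R := fine (\prod_(i | (i != a) && (i != b)) gam (A i)).
have kE : k%:E = \prod_(i | (i != a) && (i != b)) gam (A i).
  rewrite /k fineK// prode_fin_num// => i _.
  exact: fin_num_measure.
have k0 : (0 <= k)%R.
  by rewrite -lee_fin kE; apply: prode_ge0 => i _; exact: measure_ge0.
have rectE (B C : set R) : measurable B -> measurable C ->
    P (E `&` [set w | B (Z a w) /\ C (Z b w)]) = k%:E * (gam B * gam C).
  move=> mB mC.
  pose A' i := if i == a then B else if i == b then C else A i.
  have mA' i : measurable (A' i).
    by rewrite /A'; case: ifP => // _; case: ifP.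
  have -> : E `&` [set w | B (Z a w) /\ C (Z b w)]
      = [set w | forall i, A' i (Z i w)].
    apply/seteqP; split => w /=.
      move=> [Ew [Bw Cw]] i; rewrite /A'; have [->|ia] := eqVneq i a => //.
      by have [->|ib] := eqVneq i b => //; exact: Ew.
    move=> Aw; split; first by move=> i /negbTE ia /negbTE ib; have := Aw i;
      rewrite /A' ia ib.
    split; first by have := Aw a; rewrite /A' eqxx.
    by have := Aw b; rewrite /A' eq_sym (negbTE ab) eqxx.
  rewrite PZ// (bigD1 a)//= (bigD1 b)/=; last by rewrite eq_sym.
  rewrite muleA muleC kE; congr (_ * (_ * _)).
  - by apply: eq_bigr => i /andP[/negbTE ia /negbTE ib]; rewrite /A' ia ib.
  - by rewrite /A' eqxx.
  - by rewrite /A' eq_sym (negbTE ab) eqxx.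
pose C := [set z : R * R | A a (c * z.1 + t * z.2)%R /\ A b (c * z.2 - t * z.1)%R].
have mC : measurable C.
  have mrot : measurable_fun setT
      (fun z : R * R => (c * z.1 + t * z.2, c * z.2 - t * z.1)%R).
    apply: measurable_fun_pair => //.
      by apply: measurable_funD => //; exact: measurable_funM.
    by apply: measurable_funB => //; exact: measurable_funM.
  have : measurable (A a `*` A b) by exact: measurableX.
  by move=> /(mrot measurableT); rewrite setTI.
transitivity (P (E `&` ZZ @^-1` C)).
  congr (P _); apply/seteqP; split => w /=.
    move=> Aw; split.
      by move=> i /negbTE ia /negbTE ib; have := Aw i; rewrite ia ib.
    split; first by have := Aw a; rewrite eqxx.
    by have := Aw b; rewrite eq_sym (negbTE ab) eqxx.
  move=> [Ew [/= Caw Cbw]] i; have [->|ia] := eqVneq i a => //.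
  by have [->|ib] := eqVneq i b => //; exact: Ew.
(* The set [C] is a rotated rectangle, not a rectangle, so [rectE] has to be extended to all
   measurable sets by uniqueness of finite measures. *)
have := @measure_rectangles_eq _ _ _ _ _
  (pushforward (mrestr P mE) ZZ) (mscale (NngNum k0) (gam \x gam)).
rewrite /= /pushforward/= /mrestr preimage_setT setTI => h.
transitivity (P (ZZ @^-1` C `&` E)); first by rewrite setIC.
rewrite h//.
- rewrite /mscale/= product_gaussian_rot// (bigD1 a)//= (bigD1 b)//=; last by rewrite eq_sym.
  by rewrite muleA muleC kE.
- exact: (le_lt_trans (probability_le1 P mE) (ltry _)).
- move=> B D mB mD; rewrite /mscale/= product_measure1E// -rectE// setIC.
  by congr (P _).
Qed.
End GivensIid.

Section IndependentSystems.
Context d (T : measurableType d) (R : realType) (P : probability T R).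
Local Open Scope ereal_scope.

(** For fixed [B], both sides are finite measures in [A] that agree on a pi-system, hence on the
    sigma-algebra it generates. *)
Lemma independent_sigma_l (F : set (set T)) (B : set T) :
  F `<=` measurable -> setI_closed F -> F setT -> measurable B ->
  (forall A, F A -> P (A `&` B) = P A * P B) ->
  forall A, <<s F >> A -> P (A `&` B) = P A * P B.
Proof.
move=> Fm FI FT mB FB A sFA.
have PB0 : (0 <= fine (P B))%R by rewrite fine_ge0.
have PBE : (fine (P B))%:E = P B by rewrite fineK// fin_num_measure.
have := @g_sigma_algebra_measure_unique _ _ _ F Fm (fun=> setT) (fun=> FT) _
  (mrestr P mB) (mscale (NngNum PB0) P).
rewrite /= /mrestr /mscale/= PBE => ->//.
- by rewrite muleC.
- by rewrite bigcup_const.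
- by move=> C FC; rewrite muleC FB.
- by move=> _; rewrite setTI; exact: (le_lt_trans (probability_le1 P mB) (ltry _)).
Qed.

Lemma independent_sigma (F G : set (set T)) :
  F `<=` measurable -> setI_closed F -> F setT ->
  G `<=` measurable -> setI_closed G -> G setT ->
  independent_systems P F G -> independent_systems P <<s F >> <<s G >>.
Proof.
move=> Fm FI FT Gm GI GT FG A B sFA sGB.
have sFm : <<s F >> `<=` measurable.
  exact: smallest_sub (@sigma_algebra_measurable _ T) Fm.
rewrite setIC muleC.
apply: (independent_sigma_l (F := G)) => //; first exact: sFm.
move=> C GC; rewrite setIC muleC.
by apply: (independent_sigma_l (F := F)) => //; [exact: Gm|move=> D FD; exact: FG].
Qed.

End IndependentSystems.

Section IidBlocks.
Context d (T : measurableType d) (R : realType) (P : probability T R).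
Variables (g : {measure set R -> \bar R}) (gT : g setT = 1%E).
Variables (I : finType) (Z : I -> T -> R) (iidZ : iid P g Z).
Local Open Scope ereal_scope.

Definition generated_by (J : pred I) : set (set T) :=
  \bigcup_(i in [set i | J i]) preimage_set_system setT (Z i) measurable.

Let cylinders (J : pred I) : set (set T) :=
  [set E | exists2 A : I -> set R, (forall i, measurable (A i)) &
           E = [set w | forall i, J i -> A i (Z i w)]].

Lemma generated_by_measurable (J : pred I) : <<s generated_by J >> `<=` measurable.
Proof.
apply: smallest_sub (@sigma_algebra_measurable _ T) _.
move=> _ [i _ [A mA <-]]; apply: iidZ.1 => //.
Qed.

Lemma iid_cylinder (J : pred I) (A : I -> set R) :
  (forall i, measurable (A i)) ->
  P [set w | forall i, J i -> A i (Z i w)] = \prod_(i | J i) g (A i).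
Proof.
move=> mA; pose A' i := if J i then A i else setT.
have -> : [set w | forall i, J i -> A i (Z i w)] = [set w | forall i, A' i (Z i w)].
  by apply/seteqP; split => w /= h i; have := h i; rewrite /A'; case: (J i) => //; exact.
rewrite iidZ.2; last by move=> i; rewrite /A'; case: (J i).
rewrite (bigID J)/= [X in _ * X]big1 ?mule1.
  by apply: eq_bigr => i Ji; rewrite /A' Ji.
by move=> i /negbTE Ji; rewrite /A' Ji.
Qed.

(** [generated_by] is not closed under intersection, so the proof passes to cylinders, which are and
    whose sigma-algebra contains it. On a cylinder over [J] and one over the complement,
    independence is the product formula of [iid]. *)
Lemma iid_independent_blocks (J : pred I) :
  independent_systems P <<s generated_by J >> <<s generated_by (predC J) >>.
Proof.
have cm K : cylinders K `<=` measurable.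
  move=> _ [A mA ->]; apply: measurable_forall_fin => i.
  case: (K i); last by rewrite [X in measurable X](_ : _ = setT)//; apply/seteqP; split.
  rewrite [X in measurable X](_ : _ = [set w | A i (Z i w)]).
    by apply: measurable_comp_preimage => //; exact: iidZ.1.
  by apply/seteqP; split => w /= h //; exact: h.
have cI K : setI_closed (cylinders K).
  move=> _ _ [A mA ->] [B mB ->]; exists (fun i => A i `&` B i).
    by move=> i; exact: measurableI.
  apply/seteqP; split => w /=; first by move=> [Aw Bw] i Ki; split; [exact: Aw|exact: Bw].
  by move=> h; split=> i Ki; have [] := h i Ki.
have cT K : cylinders K setT.
  by exists (fun=> setT) => //; apply/seteqP; split.
have gc K : <<s generated_by K >> `<=` <<s cylinders K >>.
  apply: smallest_sub; first exact: smallest_sigma_algebra.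
  move=> _ [i Ki [A mA <-]]; apply: sub_gen_smallest.
  exists (fun j => if j == i then A else setT); first by move=> j; case: ifP.
  apply/seteqP; split => w /=.
    by move=> [_ Aw] j Kj; case: eqP => [->|].
  by move=> /(_ i Ki); rewrite eqxx.
move=> A B /gc sA /gc sB.
apply: (@independent_sigma _ _ _ P (cylinders J) (cylinders (predC J))) => //.
move=> _ _ [A' mA' ->] [B' mB' ->].
have -> : [set w | forall i, J i -> A' i (Z i w)] `&`
    [set w | forall i, predC J i -> B' i (Z i w)] =
    [set w | forall i, (if J i then A' i else B' i) (Z i w)].
  apply/seteqP; split => w /=.
    move=> [hA hB] i; case: ifPn => Ji; [exact: hA|exact: hB].
  move=> h; split=> i Ji; have := h i; first by rewrite Ji.
  by rewrite (negbTE Ji).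
rewrite (iidZ.2 (fun i => if J i then A' i else B' i)); last by move=> i; case: ifP.
rewrite !iid_cylinder//.
rewrite (bigID J)/=; congr (_ * _); apply: eq_bigr => i Ji; first by rewrite Ji.
by rewrite (negbTE Ji).
Qed.

Lemma measurable_generated_by (J : pred I) i : J i ->
  measurable_fun setT (Z i : g_sigma_algebraType (generated_by J) -> R).
Proof.
move=> Ji _ A mA; rewrite setTI; apply: sub_gen_smallest; exists i => //.
by exists A => //; rewrite setTI.
Qed.

Lemma ge0_integral_iid1 (f : R -> \bar R) i :
  measurable_fun setT f -> (forall x, 0 <= f x) ->
  \int[P]_w f (Z i w) = \int[g]_x f x.
Proof.
move=> mf f0.
have mZ := iidZ.1 i.
have := @ge0_integral_pushforward _ _ _ _ _ (Z i) mZ P setT f measurableT mf.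
rewrite preimage_setT/= => <-; last by move=> x _.
apply: (@eq_measure_integral _ _ _ _ g (pushforward P (Z i))) => A mA _.
transitivity (P [set w | forall j, pred1 i j -> A (Z j w)]).
  congr (P _); apply/seteqP; split => w /=.
    by move=> Aw j /eqP ->.
  by apply; rewrite eqxx.
by rewrite (@iid_cylinder _ (fun=> A))// big_pred1_eq.
Qed.

(** One factor is peeled off at a time: the blocks [{i}] and its complement are independent, so the
    integral of the product splits. *)
Lemma ge0_integral_iid_prod (f : I -> R -> R) (s : seq I) :
  uniq s -> (forall i, measurable_fun setT (f i)) ->
  (forall i x, 0 <= f i x)%R ->
  \int[P]_w (\prod_(i <- s) f i (Z i w))%:E = \prod_(i <- s) \int[g]_x (f i x)%:E.
Proof.
move=> us mf f0; elim: s us => [|i s IH] /=.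
  move=> _; rewrite big_nil; under eq_integral do rewrite big_nil.
  by rewrite integral_cst// mul1e; exact: probability_setT.
move=> /andP[iNs us]; rewrite big_cons -IH//.
under eq_integral do rewrite big_cons.
pose F (z : g_sigma_algebraType (generated_by (pred1 i)) *
            g_sigma_algebraType (generated_by (predC (pred1 i)))) :=
  (f i (Z i z.1) * \prod_(j <- s) f j (Z j z.2))%:E.
have mZ1 : measurable_fun setT
    (Z i : g_sigma_algebraType (generated_by (pred1 i)) -> R).
  by apply: measurable_generated_by; rewrite /= eqxx.
have mZ2 j : j \in s -> measurable_fun setT
    (Z j : g_sigma_algebraType (generated_by (predC (pred1 i))) -> R).
  move=> js; apply: measurable_generated_by => /=.
  by apply: contra iNs => /eqP <-.
have mF : measurable_fun setT F.
  apply/measurable_EFinP; apply: measurable_funM.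
    apply: measurableT_comp => //.
    exact: (measurableT_comp mZ1 measurable_fst).
  apply: measurable_prod => j js.
  apply: measurableT_comp => //.
  exact: (measurableT_comp (mZ2 _ js) measurable_snd).
have F0 z : 0 <= F z by rewrite lee_fin mulr_ge0// prodr_ge0.
have -> : \int[P]_w (f i (Z i w) * \prod_(j <- s) f j (Z j w))%:E
    = \int[P]_w F (w, w) by [].
rewrite (@ge0_integral_independent_systems _ _ _ P _ _ F)//.
- rewrite -(ge0_integral_iid1 (f := fun x => (f i x)%:E) i)//; last 2 first.
  + exact/measurable_EFinP.
  + by move=> x; rewrite lee_fin.
  rewrite -ge0_integralZr//.
  + apply: eq_integral => w1 _; rewrite -ge0_integralZl//.
    * apply/measurable_EFinP; apply: measurable_prod => j js.
      by apply: measurableT_comp => //; exact: iidZ.1.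
    * by move=> w2 _; rewrite lee_fin prodr_ge0.
    * by rewrite lee_fin.
  + by apply/measurable_EFinP; apply: measurableT_comp => //; exact: iidZ.1.
  + by move=> w1 _; rewrite lee_fin.
  + by apply: integral_ge0 => w2 _; rewrite lee_fin prodr_ge0.
- exact: generated_by_measurable.
- exact: generated_by_measurable.
- exact: iid_independent_blocks.
Qed.

End IidBlocks.

(** * Rotations of Gaussian matrices *)

Section GivensMatrix.
Context (R : comPzRingType) (n : nat).
Implicit Types (a b : 'I_n) (c t : R).

Definition givens_mx a b c t : 'M[R]_n :=
  \matrix_(k, j) (if j == a then c * (k == a)%:R + t * (k == b)%:R
                  else if j == b then c * (k == b)%:R - t * (k == a)%:R
                  else (k == j)%:R).

Lemma sum_mul_delta (F : 'I_n -> R) a : \sum_k F k * (k == a)%:R = F a.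
Proof.
rewrite (bigD1 a)//= eqxx mulr1 big1 ?addr0// => k /negbTE ->.
by rewrite mulr0.
Qed.

Lemma mulmx_givens m (M : 'M[R]_(m, n)) a b c t i j :
  (M *m givens_mx a b c t) i j =
  if j == a then c * M i a + t * M i b
  else if j == b then c * M i b - t * M i a else M i j.
Proof.
rewrite mxE; under eq_bigr do rewrite mxE.
case: ifP => _.
  under eq_bigr do rewrite mulrDr !(mulrCA (M i _)).
  by rewrite big_split/= -!mulr_sumr !sum_mul_delta.
case: ifP => _; last by rewrite sum_mul_delta.
under eq_bigr do rewrite mulrBr !(mulrCA (M i _)).
by rewrite sumrB -!mulr_sumr !sum_mul_delta.
Qed.

Lemma givens_mx_orthogonal a b c t : a != b -> c ^+ 2 + t ^+ 2 = 1 ->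
  (givens_mx a b c t)^T *m givens_mx a b c t = 1%:M.
Proof.
move=> ab ct1; apply/matrixP => i j; rewrite mulmx_givens !mxE.
have ba : (b == a) = false by rewrite eq_sym (negbTE ab).
have [ja|ja] := eqVneq j a; last have [jb|jb] := eqVneq j b;
  (have [ia|ia] := eqVneq i a; last have [ib|ib] := eqVneq i b);
  rewrite ?ja ?jb ?ia ?ib ?eqxx ?ba ?(negbTE ab) ?(eq_sym a i) ?(eq_sym b i)
    ?(eq_sym a j) ?(eq_sym b j) ?(negbTE ia) ?(negbTE ja) ?(negbTE ib)
    ?(negbTE jb); rewrite ?ba ?(negbTE ab) //=; try ring.
- by rewrite -[RHS]ct1; ring.
- by rewrite -[RHS]ct1; ring.
- by rewrite eq_sym.
Qed.

End GivensMatrix.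

Section IidRotation.
Context d (T : measurableType d) (R : realType) (P : probability T R) (s : R).
Hypothesis s0 : s != 0.
Local Notation gam := (gaussian s).

(** Rotating two columns means rotating the pair [(i, a)], [(i, b)] in every row [i]; the induction
    is on the list [r] of rows already rotated. *)
Lemma iid_givens_columns m n (Z : 'I_m * 'I_n -> T -> R) (a b : 'I_n) (c t : R) :
  iid P gam Z -> a != b -> c ^+ 2 + t ^+ 2 = 1 -> t != 0 ->
  iid P gam (fun ij w =>
    if ij.2 == a then c * Z (ij.1, a) w + t * Z (ij.1, b) w
    else if ij.2 == b then c * Z (ij.1, b) w - t * Z (ij.1, a) w
    else Z ij w).
Proof.
move=> iidZ ab ct1 t0.
pose rot (r : seq 'I_m) (ij : 'I_m * 'I_n) w :=
  if ij.1 \in r then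
    if ij.2 == a then c * Z (ij.1, a) w + t * Z (ij.1, b) w
    else if ij.2 == b then c * Z (ij.1, b) w - t * Z (ij.1, a) w
    else Z ij w
  else Z ij w.
suff h r : uniq r -> iid P gam (rot r).
  have := h (enum 'I_m) (enum_uniq _).
  congr (iid _ _ _); apply/funext => ij; apply/funext => w.
  by rewrite /rot mem_enum.
elim: r => [|i r IH]/=.
  by move=> _; rewrite (_ : rot [::] = Z)//.
move=> /andP[ir /IH iidr].
have ab' : (i, a) != (i, b) by rewrite xpair_eqE eqxx.
have := iid_givens s0 iidr ab' ct1 t0.
congr (iid _ _ _); apply/funext => -[k j]; apply/funext => w.
rewrite /rot/= !xpair_eqE in_cons (negbTE ir).
have [->{k}|ki]/= := eqVneq k i; first by rewrite (negbTE ir).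
by [].
Qed.

Definition rv_matrix m n (Z : 'I_m * 'I_n -> T -> R) (w : T) : 'M[R]_(m, n) :=
  \matrix_(i, j) Z (i, j) w.

(** Givens elimination: the entries of [Q^T *m g] are rotated one by one into position 0, and each
    rotation preserves the law of the matrix. The induction is on the list of positions already
    cleared. *)
Lemma iid_rotation_exists m n (Z : 'I_m * 'I_n.+1 -> T -> R) (g : 'cV[R]_n.+1) :
  iid P gam Z -> exists Q : 'M[R]_n.+1,
  [/\ Q^T *m Q = 1%:M,
      iid P gam (fun ij w => (rv_matrix Z w *m Q) ij.1 ij.2) &
      forall j, j != 0 -> (Q^T *m g) j 0 = 0].
Proof.
move=> iidZ.
suff h (r : seq 'I_n.+1) : exists Q : 'M[R]_n.+1,
  [/\ Q^T *m Q = 1%:M,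
      iid P gam (fun ij w => (rv_matrix Z w *m Q) ij.1 ij.2) &
      forall j, j \in r -> j != 0 -> (Q^T *m g) j 0 = 0].
  have [Q [QQ iidQ gQ]] := h (enum 'I_n.+1); exists Q; split=> // j j0.
  by rewrite gQ// mem_enum.
elim: r => [|b r [Q [QQ iidQ gQ]]].
  exists 1%:M; split=> //; first by rewrite trmx1 mulmx1.
  move: iidZ; congr (iid _ _ _); apply/funext => -[i j]; apply/funext => w.
  by rewrite mulmx1 mxE.
have [b0|b0] := eqVneq b 0.
  exists Q; split=> // j; rewrite in_cons => /orP[/eqP ->|jr]; last exact: gQ.
  by rewrite b0 eqxx.
set y := Q^T *m g in gQ.
(* An entry that is already zero is skipped, because the plane rotation is available only for a
   nonzero sine [t]. *)
have [yb|yb] := eqVneq (y b 0) 0.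
  by exists Q; split=> // j; rewrite in_cons => /orP[/eqP ->|jr]//; exact: gQ.
pose q := Num.sqrt (y 0 0 ^+ 2 + y b 0 ^+ 2).
have qq : q ^+ 2 = y 0 0 ^+ 2 + y b 0 ^+ 2.
  by rewrite sqr_sqrtr// addr_ge0 ?sqr_ge0.
have q0 : q != 0.
  rewrite -sqrf_eq0 qq gt_eqF// ltr_wpDl ?sqr_ge0//.
  by rewrite lt0r sqrf_eq0 yb sqr_ge0.
pose c := y 0 0 / q; pose t := y b 0 / q.
have ct1 : c ^+ 2 + t ^+ 2 = 1.
  by rewrite /c /t !expr_div_n -mulrDl -qq divff// sqrf_eq0.
have t0 : t != 0 by rewrite mulf_neq0 ?invr_eq0.
have b0' : 0 != b by rewrite eq_sym.
exists (Q *m givens_mx 0 b c t); split.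
- by rewrite trmx_mul mulmxA -(mulmxA _ Q^T) QQ mulmx1 givens_mx_orthogonal.
- have := iid_givens_columns iidQ b0' ct1 t0.
  congr (iid _ _ _); apply/funext => -[i j]; apply/funext => w /=.
  by rewrite mulmxA mulmx_givens.
- move=> j; rewrite in_cons trmx_mul -mulmxA -/y => jr j0.
  have -> : ((givens_mx 0 b c t)^T *m y) j 0
      = (y^T *m givens_mx 0 b c t) 0 j.
    transitivity (((y^T *m givens_mx 0 b c t)^T) j 0); last by rewrite mxE.
    by rewrite trmx_mul trmxK.
  have yT k : y^T 0 k = y k 0 by rewrite mxE.
  rewrite mulmx_givens (negbTE j0) !yT; case: ifPn => jb.
    by rewrite /c /t; ring.
  by rewrite gQ//; move: jr; rewrite (negbTE jb).
Qed.

(** In the rotated frame [g] is a multiple of the first basis vector, so the image of [g] is [q]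
    times one column. The sign of [q] is left open; its square suffices. *)
Lemma iid_rotation m n (Z : 'I_m * 'I_n.+1 -> T -> R) (g : 'cV[R]_n.+1) :
  iid P gam Z -> exists (Q : 'M[R]_n.+1) (q : R) (Z' : 'I_m * 'I_n.+1 -> T -> R),
  [/\ Q^T *m Q = 1%:M, iid P gam Z', q ^+ 2 = dotv g g,
      forall w, rv_matrix Z w = rv_matrix Z' w *m Q^T &
      forall w, rv_matrix Z w *m g = q *: col 0 (rv_matrix Z' w)].
Proof.
move=> /iid_rotation_exists-/(_ g)[Q [QQ iidQ gQ]].
have QQ' : Q *m Q^T = 1%:M by exact: mulmx1C.
exists Q, ((Q^T *m g) 0 0), (fun ij w => (rv_matrix Z w *m Q) ij.1 ij.2).
have gE : Q^T *m g = ((Q^T *m g) 0 0) *: delta_mx 0 0.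
  apply/matrixP => j k; rewrite (ord1 k) [RHS]mxE [X in _ * X]mxE eqxx andbT.
  by have [->|j0] := eqVneq j 0; rewrite ?mulr1// mulr0 gQ.
have ZE w : rv_matrix (fun ij w0 => (rv_matrix Z w0 *m Q) ij.1 ij.2) w
    = rv_matrix Z w *m Q.
  by apply/matrixP => i j; rewrite [LHS]mxE.
split=> //.
- have : dotv (Q^T *m g) (Q^T *m g) = dotv g g.
    by rewrite /dotv trmx_mul trmxK mulmxA -(mulmxA _ Q) QQ' mulmx1.
  move=> <-; rewrite /dotv [RHS]mxE.
  have tE k : (Q^T *m g)^T 0 k = (Q^T *m g) k 0 by rewrite mxE.
  rewrite (bigD1 0)//= big1 ?addr0; first by rewrite tE expr2.
  by move=> i i0; rewrite gQ ?mulr0.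
- by move=> w; rewrite ZE -mulmxA QQ' mulmx1.
- move=> w; rewrite ZE -{1}[g]mul1mx -QQ' -mulmxA mulmxA {1}gE -scalemxAr.
  by congr (_ *: _); rewrite colE.
Qed.

End IidRotation.

(** * Chi-square tails *)

Section ExpPolyBounds.
Context (R : realType).

(** The derivative of [p * expR] is [(p + deriv p) * expR]. For a Taylor polynomial of [expR (- x)]
    the sum [p + deriv p] is a single monomial, whose sign is clear. *)
Lemma horner_expR_ge (p : {poly R}) (b : R) : 0 <= b ->
  (forall x, 0 <= x <= b -> 0 <= (p + deriv p).[x]) -> p.[0] <= p.[b] * expR b.
Proof.
move=> b0 pp.
pose F : R -> R := horner p * expR.
have dF (x : R) : is_derive x (1 : R) F ((p + deriv p).[x] * expR x).
  apply: is_derive_eq; rewrite /GRing.scale/= hornerD; ring.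
have cF : {within `[0, b], continuous F}.
  apply: derivable_within_continuous => x _.
  by have [] := dF x.
have [x] := MVT_segment b0 (fun x _ => dF x) cF.
rewrite in_itv/= subr0 => xb.
have -> : F 0 = p.[0] by rewrite -[LHS]/(p.[0] * expR 0) expR0 mulr1.
rewrite -[F b]/(p.[b] * expR b) => Fb.
by rewrite -subr_ge0 Fb mulr_ge0// mulr_ge0 ?expR_ge0// pp.
Qed.

Lemma expRN_le_quadratic (x : R) : 0 <= x -> expR (- x) <= 1 - x + x ^+ 2 / 2.
Proof.
move=> x0; have := @horner_expR_ge (1 - 'X + (2^-1)%:P * 'X^2) x x0.
rewrite !(poly.derivE, hornerE)/= => h.
rewrite expRN -(ler_pM2r (expR_gt0 x)) mulVf ?gt_eqF ?expR_gt0//.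
have -> : 1 - x + x ^+ 2 / 2 = 1 - x + 2^-1 * x * x by ring.
apply: le_trans (h _); first by lra.
move=> y _; rewrite !(poly.derivE, hornerE)/=.
set z := (X in 0 <= X); have -> : z = 2^-1 * y ^+ 2 by rewrite /z; field.
by rewrite mulr_ge0 ?sqr_ge0// invr_ge0.
Qed.

Lemma expRN_ge_cubic (x : R) : 0 <= x ->
  1 - x + x ^+ 2 / 2 - x ^+ 3 / 6 <= expR (- x).
Proof.
move=> x0.
have := @horner_expR_ge (- 1 + 'X - (2^-1)%:P * 'X^2 + (6^-1)%:P * 'X^3) x x0.
rewrite !(poly.derivE, hornerE)/= => h.
rewrite expRN -(ler_pM2r (expR_gt0 x)) mulVf ?gt_eqF ?expR_gt0//.
rewrite -lerN2 -mulNr.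
have -> : - (1 - x + x ^+ 2 / 2 - x ^+ 3 / 6)
  = -1 + x - 2^-1 * x * x + 6^-1 * x * x * x by field.
apply: le_trans (h _); first by lra.
move=> y /andP[y0 _]; rewrite !(poly.derivE, hornerE)/=.
set z := (X in 0 <= X); have -> : z = 6^-1 * y ^+ 3 by rewrite /z; field.
by rewrite mulr_ge0 ?exprn_ge0// invr_ge0.
Qed.

(** This is [ln (1 - x) <= - x - x ^+ 2 / 2], the estimate behind the constant 1/4 in the lower
    tail. *)
Lemma onem_le_expRN (x : R) : 0 <= x <= 1 ->
  1 - x <= expR (- (x + x ^+ 2 / 2)).
Proof.
move=> /andP[x0 x1]; rewrite opprD expRD.
have h1 := expRN_ge_cubic x0.
have h2 : 1 - x ^+ 2 / 2 <= expR (- (x ^+ 2 / 2)) by exact: expR_ge1Dx.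
apply: le_trans (ler_pM _ _ h1 h2).
- nra.
- nra.
- nra.
Qed.

End ExpPolyBounds.

Lemma gaussian_expR_sqr (R : realType) (s a : R) : s != 0 -> 2 * a * s ^+ 2 < 1 ->
  (\int[gaussian s]_x (expR (a * x ^+ 2))%:E
    = ((Num.sqrt (1 - 2 * a * s ^+ 2))^-1)%:E)%E.
Proof.
move=> s0 as1; set k := Num.sqrt _.
have k0 : 0 < k by rewrite sqrtr_gt0 subr_gt0.
have kk : k ^+ 2 = 1 - 2 * a * s ^+ 2 by rewrite sqr_sqrtr// subr_ge0 ltW.
have sqr_scale (p : R) : s ^+ 2 * p *+ 2 = k ^+ 2 * ((s / k) ^+ 2 * p *+ 2).
  by rewrite mulrnAr mulrA -exprMn mulrCA divff ?mulr1// gt_eqF.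
have sk0 : s / k != 0 by rewrite mulf_neq0// invr_eq0 gt_eqF.
rewrite ge0_integral_gaussian; last 2 first.
- apply/measurable_EFinP; apply: measurableT_comp => //.
  by apply: measurable_funM => //; exact: measurable_funX.
- by move=> x; rewrite lee_fin expR_ge0.
transitivity (\int[lebesgue_measure]_x (k^-1%:E * (normal_pdf 0 (s / k) x)%:E))%E.
  apply: eq_integral => x _; rewrite -!EFinM; congr _%:E.
  rewrite !normal_pdfE// mulrCA [RHS]mulrA; congr (_ * _) => [|].
    rewrite /normal_peak.
    by rewrite (sqr_scale pi) sqrtrM ?sqr_ge0// sqrtr_sqr gtr0_norm// invfM.
  rewrite /normal_fun -expRD; congr expR; rewrite !subr0 -![_ ^+ 2 *+ 2]mulr_natr.
  have s20 : s ^+ 2 * 2 != 0 by rewrite mulf_neq0// sqrf_eq0.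
  have -> : (s / k) ^+ 2 * 2%:R = s ^+ 2 * 2 / (1 - 2 * a * s ^+ 2).
    by rewrite expr_div_n -kk mulrAC.
  rewrite invf_div; field.
  by rewrite s0.
rewrite ge0_integralZl//.
- by rewrite integral_normal_pdf mule1.
- by apply/measurable_EFinP; exact: measurable_normal_pdf.
- by move=> x _; rewrite lee_fin normal_pdf_ge0.
- by rewrite lee_fin invr_ge0 ltW.
Qed.

Lemma measurable_bool_set d (T : measurableType d) (b : T -> bool) :
  measurable_fun setT b -> measurable [set w | b w].
Proof.
move=> mb; have := mb measurableT [set true] I; rewrite setTI.
by congr (measurable _); apply/seteqP; split.
Qed.

Section ChiSquare.
Context d (T : measurableType d) (R : realType) (P : probability T R) (s : R).
Hypothesis s0 : s != 0.
Local Notation gam := (gaussian s).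

Lemma chi_square_mgf (I : finType) (Z : I -> T -> R) (a : R) (r : seq I) :
  iid P gam Z -> 2 * a * s ^+ 2 < 1 -> uniq r ->
  (\int[P]_w (expR (a * \sum_(i <- r) Z i w ^+ 2))%:E
    = ((Num.sqrt (1 - 2 * a * s ^+ 2))^-1 ^+ size r)%:E)%E.
Proof.
move=> iidZ as1 ur.
under eq_integral do rewrite mulr_sumr expR_sum.
rewrite (ge0_integral_iid_prod (g := gam) _ iidZ (f := fun i x => expR (a * x ^+ 2)))//.
- under eq_bigr do rewrite gaussian_expR_sqr//.
  rewrite prodEFin; congr _%:E.
  by rewrite big_const_seq count_predT iter_mulr mulr1.
- exact: probability_setT.
- move=> i; apply: measurableT_comp => //.
  by apply: measurable_funM => //; exact: measurable_funX.
Qed.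

Lemma probability_le_integral (E : set T) (Y : T -> R) :
  measurable E -> measurable_fun setT Y -> (forall w, 0 <= Y w) ->
  (forall w, E w -> 1 <= Y w) -> (P E <= \int[P]_w (Y w)%:E)%E.
Proof.
move=> mE mY Y0 EY.
have -> : P E = (\int[P]_w (\1_E w)%:E)%E by rewrite integral_indic// setIT.
apply: ge0_le_integral => //.
- exact/measurable_EFinP/measurable_indic.
- exact/measurable_EFinP.
- move=> w _; rewrite lee_fin indicE; case: (boolP (w \in E)) => [|_]; last exact: Y0.
  by rewrite inE => /EY.
Qed.

Lemma chi_square_lower_tail (I : finType) (Z : I -> T -> R) (e : R) (r : seq I) :
  iid P gam Z -> s ^+ 2 = (size r)%:R^-1 -> uniq r -> 0 < e < 1 ->
  (P [set w | \sum_(i <- r) Z i w ^+ 2 < 1 - e]%R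
    <= (expR (- ((size r)%:R * e ^+ 2 / 4)))%:E)%E.
Proof.
move=> iidZ s2 ur /andP[e0 e1].
set l : R := (size r)%:R in s2 *.
have l0 : 0 < l by rewrite -invr_gt0 -s2 lt0r sqrf_eq0 s0 sqr_ge0.
have e1' : 1 - e != 0 by rewrite gt_eqF// subr_gt0.
(* The minimiser of the Chernoff bound [expR (- a * (1 - e)) * (1 - 2 * a / l) ^ (- l / 2)]: there
   [1 - 2 * a / l] is the inverse of [1 - e]. *)
pose a : R := - (l / 2 * (e / (1 - e))).
have a0 : a <= 0.
  by rewrite /a oppr_le0 mulr_ge0 ?divr_ge0 ?subr_ge0 ?ltW.
have aE : 1 - 2 * a * s ^+ 2 = (1 - e)^-1.
  by rewrite s2 /a; field; rewrite e1' gt_eqF.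
have as1 : 2 * a * s ^+ 2 < 1 by rewrite -subr_gt0 aE invr_gt0 subr_gt0.
have mS : measurable_fun setT (fun w => \sum_(i <- r) Z i w ^+ 2).
  by apply: measurable_sum => i; apply: measurable_funX; exact: iidZ.1.
have mE : measurable [set w | \sum_(i <- r) Z i w ^+ 2 < 1 - e].
  by apply: measurable_bool_set; exact: measurable_fun_ltr.
apply: (@le_trans _ _ (\int[P]_w (expR (a * \sum_(i <- r) Z i w ^+ 2 + l * e / 2))%:E)%E).
  apply: probability_le_integral => //.
  - apply: measurableT_comp => //; apply: measurable_funD => //.
    exact: measurable_funM.
  - move=> w /=; set x := \sum_(i <- r) _ => xe.
    rewrite -[leLHS]expR0 ler_expR.
    have -> : l * e / 2 = - a * (1 - e) by rewrite /a; field.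
    have -> : a * x + - a * (1 - e) = a * (x - (1 - e)) by ring.
    by rewrite mulr_le0// subr_le0 ltW.
under eq_integral do rewrite expRD EFinM.
rewrite ge0_integralZr//.
(* The bound is a power with exponent [size r], so it is enough to compare one factor: [sqrt (1 - e)
   * expR (e / 2) <= expR (- (e ^+ 2 / 4))]. *)
- rewrite chi_square_mgf// -EFinM lee_fin aE sqrtrV ?subr_ge0 ?(ltW e1)// invrK.
  have -> : l * e / 2 = (size r)%:R * (e / 2) by rewrite -/l; field.
  have -> : - (l * e ^+ 2 / 4) = (size r)%:R * (- (e ^+ 2 / 4)).
    by rewrite -/l; field.
  rewrite !expRM_natl -exprMn lerXn2r ?nnegrE ?mulr_ge0 ?sqrtr_ge0 ?expR_ge0//.
  rewrite -ler_pdivlMr ?expR_gt0// -expRN -expRD -opprD.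
  rewrite -[leRHS]gtr0_norm ?expR_gt0// -sqrtr_sqr ler_wsqrtr//.
  rewrite -expRM_natl mulrN.
  have -> : 2%:R * (e ^+ 2 / 4 + e / 2) = e + e ^+ 2 / 2 by field.
  by rewrite onem_le_expRN// !ltW.

- apply/measurable_EFinP; apply: measurableT_comp => //.
  exact: measurable_funM.
Qed.

End ChiSquare.

Section ProjectedChiSquare.
Context d (T : measurableType d) (R : realType) (P : probability T R) (s : R).
Hypothesis s0 : s != 0.
Local Notation gam := (gaussian s).

Lemma iid_reindex (g : set R -> \bar R) (I J : finType) (Z : I -> T -> R)
    (f : J -> I) (f' : I -> J) :
  cancel f f' -> cancel f' f -> iid P g Z -> iid P g (fun j => Z (f j)).
Proof.
move=> ff' f'f [mZ PZ]; split=> [j|A mA]; first exact: mZ.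
have := PZ (fun i => A (f' i)) (fun i => mA _).
rewrite (reindex f)/=; last by exists f' => i _; [exact: ff'|exact: f'f].
under eq_bigr do rewrite ff'.
move=> <-; congr (P _); apply/seteqP; split => w /= h i.
  by have := h (f' i); rewrite f'f.
by have := h (f i); rewrite ff'.
Qed.

(** Rotating the fixed unit vector [u] onto the first axis turns the combinations of rows into one
    column of an iid matrix, up to sign. Since [iid_rotation] acts on columns, it is applied to the
    transpose, whence [sw]. *)
Lemma chi_square_mgf_comb l n (Z : 'I_l.+1 * 'I_n.+1 -> T -> R) (u : 'cV[R]_l.+1)
    (a : R) :
  iid P gam Z -> 2 * a * s ^+ 2 < 1 -> dotv u u = 1 ->
  (\int[P]_w (expR (a * \sum_(j < n) (\sum_i u i 0 * Z (i, lift 0 j) w) ^+ 2))%:E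
    = ((Num.sqrt (1 - 2 * a * s ^+ 2))^-1 ^+ n)%:E)%E.
Proof.
move=> iidZ as1 u1.
pose sw (ij : 'I_n.+1 * 'I_l.+1) := (ij.2, ij.1).
have iidZ' : iid P gam (fun ij => Z (sw ij)).
  by apply: (@iid_reindex _ _ _ _ sw (fun ij => (ij.2, ij.1))) iidZ => -[].
have [Q [q [Z' [_ iidZ'' q2 _ ZE]]]] := iid_rotation s0 u iidZ'.
have ZuE w j : \sum_i u i 0 * Z (i, j) w = q * Z' (j, 0) w.
  have /matrixP/(_ j 0) := ZE w; rewrite !mxE => <-.
  by apply: eq_bigr => i _; rewrite mxE mulrC.
under eq_integral.
  move=> w _; under eq_bigr do rewrite ZuE exprMn q2 u1 mul1r.
  rewrite -(big_map (fun j : 'I_n => (lift 0 j, 0) : 'I_n.+1 * 'I_l.+1) xpredT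
    (fun ij => Z' ij w ^+ 2)).
  over.
rewrite (chi_square_mgf s0 iidZ'')//.
  by rewrite size_map -[index_enum _]enumT size_enum_ord.
rewrite map_inj_uniq ?index_enum_uniq// => j k; case=> jk.
exact/val_inj/addnI/jk.
Qed.

(* Chernoff bound for a chi-square variable with [N] degrees of freedom, at the
   optimal parameter [t], for which [1 - 2 t = N / r^2]. *)
Lemma chi_upper_exponent (N : nat) (r t : R) : (0 < N)%N -> 0 <= t ->
  Num.sqrt N%:R + t <= r ->
  (Num.sqrt (N%:R / r ^+ 2))^-1 ^+ N * expR (- ((r ^+ 2 - N%:R) / 2))
    <= expR (- (t ^+ 2 / 2)).
Proof.
move=> N0 t0; set m := Num.sqrt _ => mtr.
have mm : N%:R = m ^+ 2 by rewrite sqr_sqrtr.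
have m0 : 0 < m by rewrite sqrtr_gt0 ltr0n.
have r0 : 0 < r by apply: lt_le_trans mtr; rewrite ltr_pwDl.
have -> : (Num.sqrt (N%:R / r ^+ 2))^-1 = r / m.
  by rewrite mm -expr_div_n sqrtr_sqr gtr0_norm ?divr_gt0// invf_div.
(* Replacing [ln (r / m)] by [r / m - 1] makes the exponent the exact square
   [- ((r - m) ^+ 2 / 2)]. *)
have h : r / m <= expR (r / m - 1).
  by apply: le_trans (expR_ge1Dx _); rewrite addrC subrK.
apply: (@le_trans _ _ (expR (r / m - 1) ^+ N * expR (- ((r ^+ 2 - N%:R) / 2)))).
  by rewrite ler_wpM2r ?expR_ge0// lerXn2r ?nnegrE ?expR_ge0// divr_ge0// ltW.
rewrite -expRM_natl -expRD ler_expR mm.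
have -> : m ^+ 2 * (r / m - 1) - (r ^+ 2 - m ^+ 2) / 2 = - ((r - m) ^+ 2 / 2).
  by field; rewrite gt_eqF.
rewrite lerN2 ler_pM2r ?invr_gt0// lerXn2r ?nnegrE//; first by lra.
by lra.
Qed.

(* With [X] the first column and [u = X / |X|], the columns other than the first
   are independent of [u], so that [|Z^T u|^2] is [|X|^2] plus a sum of [n]
   squares of Gaussians: a chi-square with [l + 1 + n] degrees of freedom. *)
Lemma projected_upper_tail l n (Z : 'I_l.+1 * 'I_n.+1 -> T -> R) (delta : R) :
  iid P gam Z -> s ^+ 2 = l.+1%:R^-1 -> 0 < delta <= 1 ->
  (P [set w | (1 + Num.sqrt (n.+1%:R / l.+1%:R)
                 + Num.sqrt (2 * ln (1 / delta) / l.+1%:R)) ^+ 2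
              * \sum_i Z (i, 0) w ^+ 2
            < \sum_j (\sum_i Z (i, 0) w * Z (i, j) w) ^+ 2]%R <= delta%:E)%E.
Proof.
move=> iidZ s2 /andP[de0 de1]; set S := _ + _ + _.
set E := [set w | _].
pose lr : R := l.+1%:R.
have lr0 : 0 < lr by rewrite ltr0n.
pose N := (l.+1 + n)%N.
pose t : R := Num.sqrt (2 * ln (1 / delta)).
have t0 : 0 <= t by exact: sqrtr_ge0.
have ln0 : 0 <= ln (1 / delta) by rewrite ln_ge0// div1r invf_ge1.
pose r := S * Num.sqrt lr.
have rE : r = Num.sqrt lr + Num.sqrt n.+1%:R + t.
  rewrite /r /S !(mulrDl _ _ (Num.sqrt lr)) mul1r -!sqrtrM ?divr_ge0 ?mulr_ge0//.
  by rewrite -/lr !divfK// gt_eqF.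
(* Origin of the first two terms of [S]: the root of [N <= l.+1 + n.+1] is at most the sum of the
   two roots. The third term of [S] is the deviation [t]. *)
have mr : Num.sqrt N%:R + t <= r.
  rewrite rE lerD2r -(ler_pXn2r (_ : (0 < 2)%N)) ?nnegrE ?addr_ge0 ?sqrtr_ge0//.
  rewrite sqrrD !sqr_sqrtr// /lr.
  rewrite addrAC -natrD (@le_trans _ _ (l.+1 + n.+1)%:R)//.
    by rewrite ler_nat /N leq_add2l.
  by rewrite lerDl mulrn_wge0// mulr_ge0 ?sqrtr_ge0.
have m0 : 0 < Num.sqrt N%:R :> R by rewrite sqrtr_gt0 ltr0n.
have r0 : 0 < r by apply: lt_le_trans mr; rewrite ltr_pwDl.
have Nr : N%:R <= r ^+ 2.
  rewrite -[leLHS]sqr_sqrtr// lerXn2r ?nnegrE ?sqrtr_ge0 ?(ltW r0)//.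
  by apply: le_trans mr; rewrite lerDl.
pose a : R := lr * (1 - N%:R / r ^+ 2) / 2.
have a0 : 0 <= a.
  by rewrite /a divr_ge0// mulr_ge0 ?(ltW lr0)// subr_ge0 ler_pdivrMr ?exprn_gt0// mul1r.
have aE : 1 - 2 * a * s ^+ 2 = N%:R / r ^+ 2.
  by rewrite s2 /a -/lr; field; rewrite !gt_eqF.
have as1 : 2 * a * s ^+ 2 < 1.
  by rewrite -subr_gt0 aE divr_gt0 ?exprn_gt0// ltr0n.
have aS : a * S ^+ 2 = (r ^+ 2 - N%:R) / 2.
  rewrite /a /r exprMn sqr_sqrtr ?(ltW lr0)//; field.
  have : S != 0 by apply: contraTneq r0 => S0; rewrite /r S0 mul0r ltxx.
  by move=> ->; rewrite gt_eqF.
pose K : R := (Num.sqrt (1 - 2 * a * s ^+ 2))^-1.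
have K1 : 1 <= K.
  rewrite /K aE invf_ge1 ?sqrtr_gt0 ?divr_gt0 ?exprn_gt0 ?ltr0n//.
  by rewrite -[leRHS]sqrtr1 ler_wsqrtr// ler_pdivrMr ?exprn_gt0// mul1r.
pose X w := \sum_i Z (i, 0) w ^+ 2.
(* [v] is the inverse square root of [X], in a form built from measurable functions. Where [X w = 0]
   its value is immaterial, since all [Z (i, 0) w], and with them all [u i w], vanish. *)
pose v w := expR (- (ln (X w) / 2)).
pose u i w := Z (i, 0) w * v w.
have vX w : 0 < X w -> v w ^+ 2 * X w = 1.
  move=> Xw; rewrite /v -expRM_natl mulrN mulrCA divff// mulr1 expRN lnK ?posrE//.
  by rewrite mulVf// gt_eqF.
pose J := [pred ij : 'I_l.+1 * 'I_n.+1 | ij.2 == 0].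
(* The first argument carries the first column and hence [u], the second the other columns. On [E],
   division by [X w] shows that the total exponent of [F (w, w)] is nonnegative. *)
pose F (z : g_sigma_algebraType (generated_by Z J) *
            g_sigma_algebraType (generated_by Z (predC J))) : R :=
  expR (a * X z.1 - a * S ^+ 2) *
  expR (a * \sum_(j < n) (\sum_i u i z.1 * Z (i, lift 0 j) z.2) ^+ 2).
have mZ1 i : measurable_fun setT
    (Z (i, 0) : g_sigma_algebraType (generated_by Z J) -> R).
  by apply: measurable_generated_by; rewrite /= eqxx.
have mZ2 i j : measurable_fun setT
    (Z (i, lift 0 j) : g_sigma_algebraType (generated_by Z (predC J)) -> R).
  by apply: measurable_generated_by.
have mX : measurable_fun setT (X : g_sigma_algebraType (generated_by Z J) -> R).
  by apply: measurable_sum => i; exact: measurable_funX.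
have mu i : measurable_fun setT (u i : g_sigma_algebraType (generated_by Z J) -> R).
  apply: measurable_funM => //; apply: measurableT_comp => //.
  apply: measurableT_comp => //; apply: measurable_funM => //.
  exact: measurableT_comp.
have mF : measurable_fun setT F.
  apply: measurable_funM; apply: measurableT_comp => //.
    apply: measurable_funB => //; apply: measurable_funM => //.
    exact: (measurableT_comp mX measurable_fst).
  apply: measurable_funM => //; apply: measurable_sum => j.
  apply: measurable_funX; apply: measurable_sum => i; apply: measurable_funM.
    exact: (measurableT_comp (mu i) measurable_fst).
  exact: (measurableT_comp (mZ2 i j) measurable_snd).
have F0 z : 0 <= F z by rewrite mulr_ge0// expR_ge0.
have mE : measurable E.
  apply: measurable_bool_set; apply: measurable_fun_ltr.
    apply: measurable_funM => //; apply: measurable_sum => i.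
    by apply: measurable_funX; exact: iidZ.1.
  apply: measurable_sum => j; apply: measurable_funX; apply: measurable_sum => i.
  by apply: measurable_funM; exact: iidZ.1.
have mFd : measurable_fun setT (fun w : T => F (w, w)).
  have h1 := measurable_id_g_sigma (generated_by_measurable iidZ (J := J)).
  have h2 := measurable_id_g_sigma (generated_by_measurable iidZ (J := predC J)).
  exact: (measurableT_comp mF (measurable_fun_pair h1 h2)).
apply: (@le_trans _ _ (\int[P]_w (F (w, w))%:E)%E).
  apply: probability_le_integral => //.
  - move=> w; rewrite /E/= -/(X w) => Ew.
    rewrite /F/= -expRD -[leLHS]expR0 ler_expR addrAC subr_ge0 -mulrDr.
    rewrite ler_wpM2l//.
    have X0 : 0 < X w.
      rewrite lt0r sumr_ge0 ?andbT => [|i _]; last exact: sqr_ge0.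
      apply: contraTneq Ew => Xw; rewrite Xw mulr0 -leNgt.
      rewrite big1// => j _; rewrite big1 ?expr0n// => i _.
      have /eqP : Z (i, 0) w ^+ 2 = 0.
        by apply: (psumr_eq0P _ Xw) => // k _; exact: sqr_ge0.
      by rewrite sqrf_eq0 => /eqP ->; rewrite mul0r.
    rewrite -(ler_pM2r X0); apply: le_trans (ltW Ew) _.
    rewrite big_ord_recl mulrDl lerD//.
    rewrite mulr_suml ler_sum// => j _.
    have -> : \sum_i u i w * Z (i, lift ord0 j) w =
        v w * \sum_i Z (i, 0) w * Z (i, lift ord0 j) w.
      by rewrite mulr_sumr; apply: eq_bigr => i _; rewrite /u mulrAC mulrC.
    by rewrite exprMn mulrAC vX// mul1r.
rewrite (@ge0_integral_independent_systems _ _ _ P _ _ (EFin \o F))//.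
- have mXT : measurable_fun setT X.
    by apply: measurable_sum => i; apply: measurable_funX; exact: iidZ.1.
  (* The inner integral is 1 where [X w = 0], as [u] is then zero. Since [1 <= K], the bound
     [K ^+ n] also holds there, and no almost-sure statement is called for. *)
  pose G w := expR (a * X w - a * S ^+ 2) * (if 0 < X w then K ^+ n else 1).
  have mG0 : measurable_fun setT (fun w => expR (a * X w - a * S ^+ 2)).
    apply: measurableT_comp => //; apply: measurable_funB => //.
    exact: measurable_funM.
  rewrite (eq_integral (fun w => (G w)%:E)); last first.
    move=> w1 _ /=; transitivity (\int[P]_w2 ((expR (a * X w1 - a * S ^+ 2))%:E *
      (expR (a * \sum_(j < n) (\sum_i u i w1 * Z (i, lift 0 j) w2) ^+ 2))%:E))%E.
      by apply: eq_integral => w2 _; rewrite -EFinM.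
    rewrite ge0_integralZl//; last first.
      apply/measurable_EFinP; apply: measurableT_comp => //.
      apply: measurable_funM => //; apply: measurable_sum => j.
      apply: measurable_funX; apply: measurable_sum => i.
      by apply: measurable_funM => //; exact: iidZ.1.
    rewrite /G [RHS]EFinM; congr (_ * _)%E.
    case: ifPn => [Xw|]; last first.
      rewrite lt0r sumr_ge0 ?andbT ?negbK => [/eqP Xw|i _]; last exact: sqr_ge0.
      have u0 i : u i w1 = 0.
        have /eqP : Z (i, 0) w1 ^+ 2 = 0.
          by apply: (psumr_eq0P _ Xw) => // k _; exact: sqr_ge0.
        by rewrite sqrf_eq0 /u => /eqP ->; rewrite mul0r.
      under eq_integral.
        move=> w _; rewrite big1 ?mulr0 ?expR0; last first.
          by move=> j _; rewrite big1 ?expr0n// => i _; rewrite u0 mul0r.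
        over.
      by rewrite integral_cst// mul1e; exact: probability_setT.
    pose uc : 'cV[R]_l.+1 := \col_i u i w1.
    have uc1 : dotv uc uc = 1.
      rewrite /dotv mxE -[RHS](vX _ Xw) mulr_sumr; apply: eq_bigr => i _.
      by rewrite !mxE /u mulrACA -!expr2 mulrC.
    rewrite -(chi_square_mgf_comb iidZ as1 uc1); apply: eq_integral => w _.
    congr (expR (_ * _))%:E; apply: eq_bigr => j _; congr (_ ^+ 2).
    by apply: eq_bigr => i _; rewrite mxE.
  apply: (@le_trans _ _ (\int[P]_w
      ((expR (a * X w))%:E * (expR (- (a * S ^+ 2)) * K ^+ n)%:E))%E).
    apply: ge0_le_integral => //.
    - move=> w _; rewrite lee_fin mulr_ge0 ?expR_ge0//.
      by case: ifP => // _; rewrite exprn_ge0// (le_trans ler01).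
    - apply/measurable_EFinP; apply: measurable_funM => //.
      by apply: measurable_fun_ifT => //; exact: measurable_fun_ltr.
    - apply: emeasurable_funM => //; apply/measurable_EFinP.
      by apply: measurableT_comp => //; exact: measurable_funM.
    - move=> w _; rewrite -EFinM lee_fin /G expRD -mulrA.
      rewrite ler_wpM2l ?expR_ge0// ler_wpM2l ?expR_ge0//.
      by case: ifP => // _; exact: exprn_ege1.
  rewrite ge0_integralZr//; last 2 first.
  - by apply/measurable_EFinP; apply: measurableT_comp => //; exact: measurable_funM.
  - by rewrite lee_fin mulr_ge0 ?expR_ge0// exprn_ge0// (le_trans ler01).
  have -> : (\int[P]_w (expR (a * X w))%:E = (K ^+ l.+1)%:E)%E.
    under eq_integral.
      move=> w _; rewrite /X -(big_map (fun i : 'I_l.+1 => (i, 0) : 'I_l.+1 * 'I_n.+1)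
        xpredT (fun ij => Z ij w ^+ 2)).
      over.
    rewrite (chi_square_mgf s0 iidZ)//.
      by rewrite size_map -[index_enum _]enumT size_enum_ord.
    by rewrite map_inj_uniq ?index_enum_uniq// => j k [].
  rewrite -EFinM lee_fin mulrCA mulrC -exprD -/N /K aE aS.
  apply: le_trans (chi_upper_exponent _ t0 mr) _ => //.
  rewrite sqr_sqrtr ?mulr_ge0// mulrAC divff// mul1r.
  by rewrite mul1r lnV ?posrE// opprK lnK ?posrE.
- exact: (generated_by_measurable iidZ).
- exact: (generated_by_measurable iidZ).
- by apply: (iid_independent_blocks _ iidZ); exact: probability_setT.
- exact/measurable_EFinP.
Qed.

End ProjectedChiSquare.

(** * Bad sketches *)

Definition sketch_bound (R : realType) (l d : nat) (delta : R) : R :=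
  1 + Num.sqrt (d%:R / l%:R) + Num.sqrt (2 * ln (1 / delta) / l%:R).

(** Squared norms make both tests polynomial inequalities in the entries, hence measurable. The
    value is boolean so that good iterations can be counted. *)
Definition good_sketch (R : realType) l d (e C : R) (M : 'M[R]_(l, d))
    (g : 'cV[R]_d) : bool :=
  ((1 - e) * dotv g g <= dotv (M *m g) (M *m g)) &&
  (dotv (M^T *m (M *m g)) (M^T *m (M *m g)) <= C ^+ 2 * dotv (M *m g) (M *m g)).

Section DotvTheory.
Context (R : realType).

Lemma dotvE n (u v : 'cV[R]_n) : dotv u v = \sum_i u i 0 * v i 0.
Proof. by rewrite /dotv mxE; apply: eq_bigr => i _; rewrite mxE. Qed.

Lemma dotvC n (u v : 'cV[R]_n) : dotv u v = dotv v u.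
Proof. by rewrite !dotvE; apply: eq_bigr => i _; rewrite mulrC. Qed.

Lemma dotvDl n (u v w : 'cV[R]_n) : dotv (u + v) w = dotv u w + dotv v w.
Proof. by rewrite /dotv linearD mulmxDl mxE. Qed.

Lemma dotvDr n (u v w : 'cV[R]_n) : dotv w (u + v) = dotv w u + dotv w v.
Proof. by rewrite dotvC dotvDl !(dotvC w). Qed.

Lemma dotvZl n a (u v : 'cV[R]_n) : dotv (a *: u) v = a * dotv u v.
Proof. by rewrite /dotv linearZ -scalemxAl mxE. Qed.

Lemma dotvZr n a (u v : 'cV[R]_n) : dotv u (a *: v) = a * dotv u v.
Proof. by rewrite dotvC dotvZl dotvC. Qed.

Lemma dotvNl n (u v : 'cV[R]_n) : dotv (- u) v = - dotv u v.
Proof. by rewrite -scaleN1r dotvZl mulN1r. Qed.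

Lemma dotv0r n (u : 'cV[R]_n) : dotv u 0 = 0.
Proof. by rewrite /dotv mulmx0 mxE. Qed.

Lemma dotv_ge0 n (u : 'cV[R]_n) : 0 <= dotv u u.
Proof. by rewrite dotvE sumr_ge0// => i _; rewrite -expr2 sqr_ge0. Qed.

Lemma dotv_mulmxl m n (A : 'M[R]_(m, n)) (u : 'cV[R]_n) (v : 'cV[R]_m) :
  dotv (A *m u) v = dotv u (A^T *m v).
Proof. by rewrite /dotv trmx_mul mulmxA. Qed.

Lemma sqr_norm2 n (u : 'cV[R]_n) : norm2 u ^+ 2 = dotv u u.
Proof. by rewrite sqr_sqrtr// dotv_ge0. Qed.

Lemma norm2_ge0 n (u : 'cV[R]_n) : 0 <= norm2 u.
Proof. exact: sqrtr_ge0. Qed.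

Lemma dotv_eq0 n (u : 'cV[R]_n) : (dotv u u == 0) = (u == 0).
Proof.
apply/eqP/eqP => [|->]; last by rewrite dotv0r.
rewrite dotvE => h; apply/matrixP => i j; rewrite (ord1 j) mxE.
have /eqP : u i 0 * u i 0 = 0.
  by apply: (psumr_eq0P _ h) => // k _; rewrite -expr2 sqr_ge0.
by rewrite mulf_eq0 orbb => /eqP.
Qed.

Lemma norm2_eq0 n (u : 'cV[R]_n) : (norm2 u == 0) = (u == 0).
Proof. by rewrite -dotv_eq0 -sqr_norm2 sqrf_eq0. Qed.

Lemma dotv_le_norm2 n (u v : 'cV[R]_n) : dotv u v <= norm2 u * norm2 v.
Proof.
have [v0|v0] := eqVneq v 0.
  by rewrite v0 dotv0r mulr_ge0 ?norm2_ge0.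
have vv : 0 < dotv v v by rewrite lt0r dotv_eq0 v0 dotv_ge0.
apply: le_trans (ler_norm _) _.
rewrite -(ler_pXn2r (_ : (0 < 2)%N)) ?nnegrE ?mulr_ge0 ?norm2_ge0//.
rewrite real_normK ?num_real// exprMn !sqr_norm2.
have := dotv_ge0 (u - (dotv u v / dotv v v) *: v).
rewrite dotvDl !dotvDr -scaleNr !dotvZl !dotvZr (dotvC v u).
set a := dotv u u; set b := dotv v v in vv *; set p := dotv u v => h.
suff : 0 <= a * b - p ^+ 2 by rewrite subr_ge0.
have -> : a * b - p ^+ 2 =
    (a + - (p / b) * p + (- (p / b) * p + - (p / b) * (- (p / b) * b))) * b.
  by field; rewrite gt_eqF.
by rewrite mulr_ge0// ltW.
Qed.

Lemma norm2D n (u v : 'cV[R]_n) : norm2 (u + v) <= norm2 u + norm2 v.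
Proof.
rewrite -(ler_pXn2r (_ : (0 < 2)%N)) ?nnegrE ?addr_ge0 ?norm2_ge0//.
rewrite sqrrD !sqr_norm2 dotvDl !dotvDr (dotvC v u) addrACA -addrA.
have := dotv_le_norm2 u v; lra.
Qed.

Lemma norm2Z n a (u : 'cV[R]_n) : 0 <= a -> norm2 (a *: u) = a * norm2 u.
Proof.
move=> a0; rewrite /norm2 dotvZl dotvZr mulrA -expr2 sqrtrM ?sqr_ge0//.
by rewrite sqrtr_sqr ger0_norm.
Qed.

End DotvTheory.

Section BadSketch.
Context d0 (T : measurableType d0) (R : realType) (P : probability T R).

Lemma scaled_gaussian_iid l d (S : 'M[{RV P >-> R}]_(l, d)) :
  scaled_gaussian S ->
  iid P (gaussian (Num.sqrt l%:R^-1)) (fun ij => (S ij.1 ij.2 : T -> R)).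
Proof.
move=> [indep dist]; split=> [ij|A mA]; first exact: measurable_funPT.
have := indep [set: 'I_l * 'I_d]%SET A mA.
rewrite (eq_bigl xpredT); last by move=> ij; rewrite inE.
under eq_bigr => ij _.
  rewrite (_ : P _ = distribution P (S ij.1 ij.2) (A ij))// dist// -gaussianE.
  over.
move=> <-; congr (P _); apply/seteqP; split => w /= h ij; first by move=> _; exact: h.
by apply: (h ij); rewrite /= inE.
Qed.


Lemma bad_sketch_probability l d (S : 'M[{RV P >-> R}]_(l.+1, d.+1))
    (g : 'cV[R]_d.+1) (e delta : R) :
  scaled_gaussian S -> 0 < e < 1 -> 0 < delta <= 1 ->
  measurable [set w | ~~ good_sketch e (sketch_bound l.+1 d.+1 delta) (mxval S w) g] ->
  (P [set w | ~~ good_sketch e (sketch_bound l.+1 d.+1 delta) (mxval S w) g]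
    <= (expR (- (l.+1%:R * e ^+ 2 / 4)) + delta)%:E)%E.
Proof.
move=> /scaled_gaussian_iid iidS e01 de mB.
set s := Num.sqrt _ in iidS.
have s2 : s ^+ 2 = l.+1%:R^-1 by rewrite sqr_sqrtr.
have s0 : s != 0 by rewrite -sqrf_eq0 s2 invr_eq0 pnatr_eq0.
have [Q [q [Z [QQ iidZ q2 SE SgE]]]] := iid_rotation s0 g iidS.
have SvE w : mxval S w = rv_matrix (fun ij => (S ij.1 ij.2 : T -> R)) w.
  by apply/matrixP => i j; rewrite !mxE.
have SgSg w : dotv (mxval S w *m g) (mxval S w *m g)
    = q ^+ 2 * \sum_i Z (i, 0) w ^+ 2.
  rewrite SvE SgE dotvZl dotvZr mulrA -expr2 dotvE; congr (_ * _).
  by apply: eq_bigr => i _; rewrite !mxE expr2.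
have SSgSSg w : dotv ((mxval S w)^T *m (mxval S w *m g))
      ((mxval S w)^T *m (mxval S w *m g))
    = q ^+ 2 * \sum_j (\sum_i Z (i, 0) w * Z (i, j) w) ^+ 2.
  rewrite SvE SgE SE trmx_mul trmxK -!mulmxA dotv_mulmxl.
  rewrite [X in dotv _ X]mulmxA QQ mul1mx -!scalemxAr dotvZl dotvZr.
  rewrite mulrA -expr2 dotvE; congr (_ * _); apply: eq_bigr => j _.
  rewrite -expr2; congr (_ ^+ 2); rewrite mxE; apply: eq_bigr => i _.
  by rewrite !mxE mulrC.
pose E1 := [set w | \sum_i Z (i, 0) w ^+ 2 < 1 - e].
pose E2 := [set w | sketch_bound l.+1 d.+1 delta ^+ 2 * \sum_i Z (i, 0) w ^+ 2
            < \sum_j (\sum_i Z (i, 0) w * Z (i, j) w) ^+ 2].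
have mX : measurable_fun setT (fun w => \sum_i Z (i, 0) w ^+ 2).
  by apply: measurable_sum => i; apply: measurable_funX; exact: iidZ.1.
have mE1 : measurable E1.
  by apply: measurable_bool_set; exact: measurable_fun_ltr.
have mE2 : measurable E2.
  apply: measurable_bool_set; apply: measurable_fun_ltr.
    exact: measurable_funM.
  apply: measurable_sum => j; apply: measurable_funX; apply: measurable_sum => i.
  by apply: measurable_funM; exact: iidZ.1.
set B := [set w | _] in mB *.
have BE : B `<=` E1 `|` E2.
  move=> w; rewrite /B /= /good_sketch SSgSSg SgSg -q2 negb_and -!ltNge.
  (* If [g = 0] both tests read [0 <= 0], so a bad sketch forces [q ^+ 2 > 0] and this common factor
     can be cancelled. *)
  move=> h; have q20 : 0 < q ^+ 2.
    rewrite lt0r sqr_ge0 andbT; apply: contraTneq h => ->.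
    by rewrite !(mul0r, mulr0) ltxx.
  case/orP: h => h; [left|right]; rewrite /E1 /E2 /= -(ltr_pM2l q20).
    by rewrite (mulrC _ (1 - e)).
  by rewrite mulrCA.
apply: (@le_trans _ _ (P (E1 `|` E2))).
  by apply: le_measure => //; rewrite inE; [exact: mB|exact: measurableU].
apply: le_trans (measureU2 _ _ _) _ => //.
rewrite EFinD; apply: leeD; last exact: (projected_upper_tail s0 iidZ s2 de).
have := @chi_square_lower_tail _ _ _ P s s0 _ Z e
  (map (fun i : 'I_l.+1 => (i, 0) : 'I_l.+1 * 'I_d.+1) (index_enum 'I_l.+1)) iidZ.
rewrite size_map -[index_enum _]enumT size_enum_ord => /(_ s2) h.
rewrite /E1; under eq_set do rewrite -(big_map (fun i : 'I_l.+1 =>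
  (i, 0) : 'I_l.+1 * 'I_d.+1) xpredT (fun ij => Z ij _ ^+ 2)).
rewrite -[index_enum _]enumT; apply: h => //.
by rewrite map_inj_uniq ?enum_uniq// => j k [].
Qed.

End BadSketch.

(** * Measurable random matrices and the sketch given the past *)

Section MeasurableMatrix.
Context d0 (T : measurableType d0) (R : realType).

Definition measurable_mx m n (M : T -> 'M[R]_(m, n)) : Prop :=
  forall i j, measurable_fun setT (fun w => M w i j).

Lemma measurable_mx_cst m n (M : 'M[R]_(m, n)) : measurable_mx (fun=> M).
Proof. by move=> i j; exact: measurable_cst. Qed.

Lemma measurable_mx_mul m n p (M : T -> 'M[R]_(m, n)) (M' : T -> 'M[R]_(n, p)) :
  measurable_mx M -> measurable_mx M' -> measurable_mx (fun w => M w *m M' w).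
Proof.
move=> mM mM' i j; under eq_fun do rewrite mxE.
by apply: measurable_sum => k; exact: measurable_funM.
Qed.

Lemma measurable_mx_tr m n (M : T -> 'M[R]_(m, n)) :
  measurable_mx M -> measurable_mx (fun w => (M w)^T).
Proof. by move=> mM i j; apply: eq_measurable_fun (mM j i) => w _; rewrite mxE. Qed.

Lemma measurable_mx_add m n (M M' : T -> 'M[R]_(m, n)) :
  measurable_mx M -> measurable_mx M' -> measurable_mx (fun w => M w + M' w).
Proof.
by move=> mM mM' i j; under eq_fun do rewrite mxE; exact: measurable_funD.
Qed.

Lemma measurable_dotv n (u v : T -> 'cV[R]_n) :
  measurable_mx u -> measurable_mx v ->
  measurable_fun setT (fun w => dotv (u w) (v w)).
Proof.
by move=> mu mv; exact: (measurable_mx_mul (measurable_mx_tr mu) mv 0 0).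
Qed.

Lemma measurable_good_sketch l d (e C : R) (M : T -> 'M[R]_(l, d)) (g : T -> 'cV[R]_d) :
  measurable_mx M -> measurable_mx g ->
  measurable_fun setT (fun w => good_sketch e C (M w) (g w)).
Proof.
move=> mM mg; have mMg := measurable_mx_mul mM mg.
have mMMg := measurable_mx_mul (measurable_mx_tr mM) mMg.
apply: measurable_and; apply: measurable_fun_ler; rewrite ?measurable_dotv//.
- by apply: measurable_funM => //; exact: measurable_dotv.
- exact: measurable_dotv.
- exact: measurable_dotv.
- by apply: measurable_funM => //; exact: measurable_dotv.
Qed.

End MeasurableMatrix.

Section SketchGivenPast.
Context d0 (T : measurableType d0) (R : realType) (P : probability T R).

Lemma entry_events_measurable m n (X : 'M[{RV P >-> R}]_(m, n)) :
  <<s entry_events X >> `<=` measurable.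
Proof.
apply: smallest_sub (@sigma_algebra_measurable _ T) _ => _ [ij _ [A mA <-]].
exact: measurable_funPT.
Qed.

Lemma measurable_mx_entry_events m n (X : 'M[{RV P >-> R}]_(m, n)) :
  measurable_mx (mxval X : g_sigma_algebraType (entry_events X) -> 'M[R]_(m, n)).
Proof.
move=> i j; under eq_fun do rewrite mxE.
move=> _ A mA; rewrite setTI; apply: sub_gen_smallest; exists (i, j) => //.
by exists A => //; rewrite setTI.
Qed.

(** Decoupling freezes the past outcome [w1], so that [g w1] is a fixed vector and the unconditional
    bound applies to the inner integral. The indicator of [H] depends on [w1] alone and contributes
    the factor [P H]. *)
Lemma bad_sketch_given_past l d (S : 'M[{RV P >-> R}]_(l.+1, d.+1))
    (G : set (set T)) (g : g_sigma_algebraType G -> 'cV[R]_d.+1) (H : set T)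
    (e delta : R) :
  <<s G >> `<=` measurable -> independent_systems P <<s entry_events S >> <<s G >> ->
  measurable_mx g -> <<s G >> H ->
  scaled_gaussian S -> 0 < e < 1 -> 0 < delta <= 1 ->
  (P ([set w | ~~ good_sketch e (sketch_bound l.+1 d.+1 delta) (mxval S w) (g w)]
      `&` H)
    <= (expR (- (l.+1%:R * e ^+ 2 / 4)) + delta)%:E * P H)%E.
Proof.
move=> sG indep mg sH SG e01 de; set C := sketch_bound _ _ _.
pose bad (z : g_sigma_algebraType G * g_sigma_algebraType (entry_events S)) :=
  ~~ good_sketch e C (mxval S z.2) (g z.1).
pose F z : R := \1_[set z | bad z] z * \1_(H : set (g_sigma_algebraType G)) z.1.
have mbad : measurable_fun setT bad.
  apply: measurable_neg; apply: measurable_good_sketch.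
    move=> i j.
    exact: (measurableT_comp (@measurable_mx_entry_events _ _ S i j) measurable_snd).
  by move=> i j; exact: (measurableT_comp (mg i j) measurable_fst).
have mF : measurable_fun setT F.
  apply: measurable_funM; first exact/measurable_indic/measurable_bool_set.
  apply: measurableT_comp => //; exact: measurable_indic.
have F0 z : (0 <= (EFin \o F) z)%E by rewrite lee_fin /F mulr_ge0.
have mid1 := measurable_id_g_sigma sG.
have mid2 := measurable_id_g_sigma (@entry_events_measurable _ _ S).
have mH : measurable H by exact: sG.
have mbadT : measurable [set w : T | bad (w, w)].
  apply: measurable_bool_set.
  exact: (measurableT_comp mbad (measurable_fun_pair mid1 mid2)).
have -> : P ([set w | bad (w, w)] `&` H) = (\int[P]_w (F (w, w))%:E)%E.
  transitivity (\int[P]_w (\1_([set w | bad (w, w)] `&` H) w)%:E)%E.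
    by rewrite integral_indic ?setIT//; exact: measurableI.
  by apply: eq_integral => w _; rewrite /F indicI.
rewrite (@ge0_integral_independent_systems _ _ _ P _ _ (EFin \o F))//; last 3 first.
- exact: (@entry_events_measurable _ _ S).
- by move=> A B sA sB; rewrite setIC muleC indep.
- exact/measurable_EFinP.
have c0 : 0 <= expR (- (l.+1%:R * e ^+ 2 / 4)) + delta.
  by case/andP: de => d1 _; rewrite addr_ge0 ?expR_ge0// ltW.
have mSw2 : measurable_mx (mxval S : T -> _).
  by move=> i j; under eq_fun do rewrite mxE; exact: measurable_funPT.
apply: (@le_trans _ _ (\int[P]_w
    ((expR (- (l.+1%:R * e ^+ 2 / 4)) + delta)%:E * (\1_H w)%:E))%E); last first.
  rewrite ge0_integralZl//; last exact/measurable_EFinP/measurable_indic.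
  by rewrite integral_indic// setIT.
apply: ge0_le_integral => //.
- by move=> w _; apply: integral_ge0 => w2 _; exact: F0.
- have mF' : measurable_fun setT (fun z : T * T => (F (z.1, z.2))%:E).
    apply/measurable_EFinP; apply: (measurableT_comp mF).
    apply: measurable_fun_pair.
      exact: (measurableT_comp mid1 measurable_fst).
    exact: (measurableT_comp mid2 measurable_snd).
  have := @measurable_fun_fubini_tonelli_F _ _ _ _ _ P _ mF' (fun z => F0 _).
  by apply.
- by apply: emeasurable_funM => //; exact/measurable_EFinP/measurable_indic.
- move=> w1 _ /=; case: (boolP (w1 \in H)) => w1H; last first.
    rewrite indicE (negbTE w1H) mule0 integral0_eq// => w2 _.
    by rewrite /F/= [X in _ * X]indicE (negbTE w1H) mulr0.
  rewrite indicE w1H mule1.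
  have mb1 : measurable [set w2 : T | ~~ good_sketch e C (mxval S w2) (g w1)].
    apply: measurable_bool_set; apply: measurable_neg.
    exact: (@measurable_good_sketch _ T _ _ _ e C (mxval S) (fun=> g w1) mSw2
      (@measurable_mx_cst _ T _ _ _ (g w1))).
  have hb := bad_sketch_probability SG e01 de mb1.
  rewrite (_ : (\int[P]_w2 _)%E
    = P [set w2 : T | ~~ good_sketch e C (mxval S w2) (g w1)])//.
  transitivity (\int[P]_w2
      (\1_[set w2 : T | ~~ good_sketch e C (mxval S w2) (g w1)] w2)%:E)%E.
    apply: eq_integral => w2 _.
    by rewrite /F/= [X in _ * X]indicE w1H mulr1.
  by rewrite integral_indic// setIT.
Qed.

End SketchGivenPast.

(** * Concentration of the number of good iterations *)

Section ConditionalChernoff.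
Context d0 (T : measurableType d0) (R : realType) (P : probability T R).
Variables (good : nat -> T -> bool) (past : nat -> set (set T)) (N : nat) (q : R).
Hypothesis q01 : 0 <= q <= 1.
Hypothesis mgood : forall k, (k < N)%N -> measurable [set w | good k w].

Definition count_good k w : nat := \sum_(i < k) good i w.

Hypothesis past_count : forall k j, (k < N)%N ->
  past k [set w | count_good k w = j].
Hypothesis bad_le : forall k H, (k < N)%N -> past k H ->
  (P ([set w | ~~ good k w] `&` H) <= q%:E * P H)%E.

Let A k j := [set w | count_good k w = j].
Let p k j : R := fine (P (A k j)).

Lemma count_goodS k w : count_good k.+1 w = (count_good k w + good k w)%N.
Proof. by rewrite /count_good big_ord_recr. Qed.

Lemma count_good_le k w : (count_good k w <= k)%N.
Proof.
elim: k => [|k IH]; first by rewrite /count_good big_ord0.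
by rewrite count_goodS -addn1 leq_add// leq_b1.
Qed.

Let measurableA k j : (k <= N)%N -> measurable (A k j).
Proof.
elim: k j => [|k IH] j kN.
  rewrite /A [X in measurable X](_ : _ = if j == 0%N then setT else set0).
    by case: ifP.
  apply/seteqP; rewrite /count_good; split => w /=; rewrite big_ord0.
    by move=> <-.
  by case: eqP.
rewrite [X in measurable X](_ : _ = (A k j `&` [set w | ~~ good k w]) `|`
    (if j is j'.+1 then A k j' `&` [set w | good k w] else set0)).
  apply: measurableU.
    apply: measurableI; first exact/IH/ltnW.
    rewrite [X in measurable X](_ : _ = ~` [set w | good k w]).
      exact/measurableC/(mgood kN).
    by apply/seteqP; split => w /negP.
  case: j => [//|j]; apply: measurableI; first exact/IH/ltnW.
  exact: (mgood kN).
apply/seteqP; rewrite /A; split => w /=; rewrite count_goodS.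
  case gw: (good k w); rewrite ?addn0 ?addn1; last by left.
  by move=> <-; right; split.
case=> [[-> /negbTE ->]|]; first by rewrite addn0.
by case: j => //= j [-> ->]; rewrite addn1.
Qed.

Let PE (B : set T) : measurable B -> P B = (fine (P B))%:E.
Proof. by move=> mB; rewrite fineK// fin_num_measure. Qed.

(** The left side is the generating function of the number of good iterations, written over its
    values. One iteration multiplies it by at most [x + (1 - x) * q]: on each level set of the
    count, the bad part has mass at most [q] times the whole, and [x <= 1] makes the bad part the
    costlier one. *)
Lemma count_good_mgf (x : R) k : 0 <= x <= 1 -> (k <= N)%N ->
  \sum_(j < k.+1) x ^+ j * p k j <= (x + (1 - x) * q) ^+ k.
Proof.
move=> /andP[x0 x1]; elim: k => [|k IH] kN.
  rewrite big_ord_recl big_ord0 addr0 !expr0 mul1r /p -lee_fin -PE; last exact: measurableA.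
  exact/probability_le1/measurableA.
have mg := mgood kN.
have mb : measurable [set w | ~~ good k w].
  rewrite [X in measurable X](_ : _ = ~` [set w | good k w]).
    exact: measurableC.
  by apply/seteqP; split => w /negP.
have mA j := measurableA j (ltnW kN).
pose b j := fine (P (A k j `&` [set w | ~~ good k w])).
have b0 j : 0 <= b j by rewrite fine_ge0.
have bq j : b j <= q * p k j.
  rewrite -lee_fin EFinM /b /p -!PE//; last exact: measurableI.
  by rewrite setIC; apply: bad_le => //; exact: past_count.
have split_p j : fine (P (A k j `&` [set w | good k w])) = p k j - b j.
  apply/eqP; rewrite -subr_eq opprK -eqe EFinD /b /p -!PE//; try exact: measurableI.
  rewrite -measureU//; try exact: measurableI.
    rewrite -setIUr [X in _ `&` X](_ : _ = setT) ?setIT//.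
    by apply/seteqP; split => w //= _; case: (good k w); [left|right].
  by apply/seteqP; split => w //= [[_ gw] [_]]; rewrite gw.
have pS j : p k.+1 j.+1 <= b j.+1 + (p k j - b j).
  rewrite -split_p -lee_fin EFinD /b /p -!PE//; try exact: measurableI; last first.
    exact: measurableA.
  apply: le_trans (measureU2 _ _ _); try exact: measurableI.
  apply: le_measure; rewrite ?inE; first exact: measurableA.
    by apply: measurableU; exact: measurableI.
  move=> w; rewrite /A /= count_goodS.
  case: (good k w); rewrite ?addn0 ?addn1; last by left.
  by move=> [->]; right.
have p0 : p k.+1 0 <= b 0%N.
  rewrite -lee_fin /b /p -!PE//; try exact: measurableI; last exact: measurableA.
  apply: le_measure; rewrite ?inE; [exact: measurableA|exact: measurableI|].
  by move=> w; rewrite /A /= count_goodS; case: (good k w); rewrite ?addn0 ?addn1.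
have bk : b k.+1 = 0.
  rewrite /b [X in P X](_ : _ = set0) ?measure0//.
  apply/seteqP; split => w //= [Akw _].
  by have := count_good_le k w; rewrite Akw ltnn.
apply: (@le_trans _ _ ((x + (1 - x) * q) * \sum_(j < k.+1) x ^+ j * p k j)); last first.
  rewrite exprS ler_wpM2l ?IH ?(ltnW kN)//.
  by case/andP: q01 => *; rewrite addr_ge0// mulr_ge0// subr_ge0.
rewrite big_ord_recl expr0 mul1r.
apply: (@le_trans _ _ (b 0%N + \sum_(j < k.+1) x ^+ j.+1 * (b j.+1 + (p k j - b j)))).
  by rewrite lerD//; apply: ler_sum => j _; rewrite ler_wpM2l ?exprn_ge0// pS.
have -> : b 0%N + \sum_(j < k.+1) x ^+ j.+1 * (b j.+1 + (p k j - b j))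
    = \sum_(j < k.+1) x ^+ j * (x * p k j + (1 - x) * b j).
  transitivity (\sum_(j < k.+2) x ^+ j * b j
      + \sum_(j < k.+1) x ^+ j.+1 * (p k j - b j)).
    rewrite [in RHS]big_ord_recl expr0 mul1r -addrA -big_split/=; congr (_ + _).
    by apply: eq_bigr => j _; rewrite mulrDr.
  rewrite [X in X + _]big_ord_recr/= bk mulr0 addr0 -big_split/=.
  by apply: eq_bigr => j _; rewrite exprS; ring.
rewrite mulr_sumr; apply: ler_sum => j _.
rewrite [leRHS]mulrCA ler_wpM2l ?exprn_ge0// [leRHS]mulrDl lerD2l -mulrA.
by rewrite ler_wpM2l// subr_ge0.
Qed.

Lemma conditional_chernoff (delta : R) : 0 <= delta ->
  (P [set w | ((count_good N w)%:R < (1 - delta) * ((1 - q) * N%:R))%R]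
    <= (expR (- (delta ^+ 2 / 2 * (1 - q) * N%:R)))%:E)%E.
Proof.
move=> de0; set c := (1 - delta) * _.
(* With this [x], the quadratic bound on [expR (- delta)] leaves the exponent [delta * (1 - delta) -
   (delta - delta ^+ 2 / 2) = - (delta ^+ 2 / 2)] per unit of [(1 - q) * N]. It serves for every
   [delta >= 0]. *)
pose x := expR (- delta).
have x01 : 0 <= x <= 1 by rewrite expR_ge0 expR_le1 oppr_le0.
have q1 : 0 <= 1 - q by case/andP: q01 => *; rewrite subr_ge0.
set E := [set w | _].
have PEle : (P E <= \sum_(j < N.+1) (expR (delta * c) * (x ^+ j * p N j))%:E)%E.
  pose F (j : nat) := if (j%:R < c)%R then A N j else set0.
  have mF j : measurable (F j) by rewrite /F; case: ifP => // _; exact: measurableA.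
  have EF : E = \big[setU/set0]_(j < N.+1) F j.
    rewrite -bigcup_mkord_ord; apply/seteqP; split => w.
      move=> Ew; exists (count_good N w); first by rewrite /= ltnS count_good_le.
      by rewrite inordK ?ltnS ?count_good_le// /F; move: Ew; rewrite /E /= => ->.
    move=> [j /= jN]; rewrite inordK// /F; case: ifP => //= jc.
    by rewrite /A /E /= => ->.
  rewrite EF.
  apply: le_trans (Boole_inequality _ _) _ => //.
  apply: lee_sum => j _; rewrite /F; case: ifP => [jc|_].
    rewrite -[X in (X <= _)%E]/(P (A N j)) PE; last exact: measurableA.
    rewrite lee_fin mulrA ler_peMl ?fine_ge0// /x -expRM_natl -expRD.
    rewrite -[leLHS]expR0 ler_expR mulrN (mulrC j%:R) -mulrBr mulr_ge0// subr_ge0 ltW//.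
  by rewrite measure0 lee_fin mulr_ge0 ?expR_ge0// mulr_ge0 ?exprn_ge0 ?expR_ge0// fine_ge0.
apply: (le_trans PEle); rewrite sumEFin lee_fin -mulr_sumr.
apply: (@le_trans _ _ (expR (delta * c) * (x + (1 - x) * q) ^+ N)).
  by rewrite ler_wpM2l ?expR_ge0//; exact: count_good_mgf.
have xq : x + (1 - x) * q <= expR (- ((1 - q) * (delta - delta ^+ 2 / 2))).
  apply: le_trans (expR_ge1Dx _).
  have := expRN_le_quadratic de0; rewrite -/x => hx.
  have -> : x + (1 - x) * q = q + (1 - q) * x by ring.
  have := ler_wpM2l q1 hx; lra.
apply: (@le_trans _ _ (expR (delta * c) * expR (- ((1 - q) * (delta - delta ^+ 2 / 2))) ^+ N)).
  rewrite ler_wpM2l ?expR_ge0// lerXn2r ?nnegrE ?expR_ge0//.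
  by case/andP: q01 => *; case/andP: x01 => *; rewrite addr_ge0// mulr_ge0// subr_ge0.
rewrite -expRM_natl -expRD ler_expR /c le_eqVlt; apply/orP; left; apply/eqP.
by field.
Qed.

End ConditionalChernoff.

Section ContinuousMeasurable.
Context d0 (T : measurableType d0) (R : realType).

(* The matrix space carries no Borel structure here: [F] is approximated by its
   values at the points of the grids [(k + 1)^-1 Z^n], which are countable. *)
Lemma measurable_continuous_mx n (F : 'cV[R]_n -> R) (X : T -> 'cV[R]_n) :
  continuous F -> measurable_mx X -> measurable_fun setT (fun w => F (X w)).
Proof.
move=> cF mX.
pose r (k : nat) (v : 'cV[R]_n) : {ffun 'I_n -> int} :=
  [ffun i => Num.floor (k.+1%:R * v i 0)].
pose rnd (k : nat) (z : {ffun 'I_n -> int}) : 'cV[R]_n :=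
  \col_i ((z i)%:~R / k.+1%:R).
have mr k z : measurable [set w | r k (X w) = z].
  rewrite [X in measurable X](_ : _ = [set w | forall i,
      (z i)%:~R <= k.+1%:R * X w i 0 < (z i + 1)%:~R]).
    apply: measurable_forall_fin => i; apply: measurable_bool_set.
    have mkX : measurable_fun setT (fun w => k.+1%:R * X w i 0).
      exact: measurable_funM.
    by apply: measurable_and; [exact: measurable_fun_ler|exact: measurable_fun_ltr].
  apply/seteqP; split => w /=.
    by move=> <- i; rewrite ffunE floor_itv.
  by move=> h; apply/ffunP => i; rewrite ffunE; apply/eqP; rewrite floor_eq h.
apply: (@measurable_fun_cvg _ _ _ _ (fun k w => F (rnd k (r k (X w))))).
  move=> k _ A mA; rewrite setTI.
  rewrite [X in measurable X](_ : _ = \bigcup_z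
    (if F (rnd k z) \in A then [set w | r k (X w) = z] else set0)).
    by apply: countable_bigcupT_measurable => // z; case: ifP.
  apply/seteqP; split => w /=.
    by move=> Aw; exists (r k (X w)) => //; rewrite mem_set.
  by move=> [z _]; case: ifPn => // /set_mem Az /= ->.
move=> w _.
apply: (@cvg_comp _ _ _ (fun k => rnd k (r k (X w))) F _ (nbhs (X w))); last exact: cF.
apply/cvg_ballP => e e0; near=> k; split => // i j.
rewrite (ord1 j) /ball/= /rnd mxE ffunE.
have k0 : 0 < k.+1%:R :> R by rewrite ltr0n.
have /andP[h1 h2] := floor_itv (k.+1%:R * X w i 0).
set z := (Num.floor _)%:~R in h1 *.
have {h2} : k.+1%:R * X w i 0 < z + 1 by move: h2; rewrite rmorphD.
rewrite mulrC -ltr_pdivlMr// mulrDl => h2.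
have {}h1 : z / k.+1%:R <= X w i 0 by rewrite ler_pdivrMr// mulrC.
rewrite ger0_norm ?subr_ge0//.
apply: (@lt_le_trans _ _ (1 / k.+1%:R)); first by rewrite ltrBlDl.
rewrite div1r ltW//; near: k.
exact: (near_infty_natSinv_lt (PosNum e0)).
Unshelve. all: by end_near.
Qed.

End ContinuousMeasurable.

Section MeasurableMisc.
Context d0 (T : measurableType d0) (R : realType).

Lemma measurable_mx_if m n (b : T -> bool) (M M' : T -> 'M[R]_(m, n)) :
  measurable_fun setT b -> measurable_mx M -> measurable_mx M' ->
  measurable_mx (fun w => if b w then M w else M' w).
Proof.
move=> mb mM mM' i j.
apply: eq_measurable_fun (measurable_fun_ifT mb (mM i j) (mM' i j)) => w _.
by case: (b w).
Qed.

Lemma measurable_fun_sub_sigma d' (U : measurableType d') (G G' : set (set T))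
    (f : T -> U) :
  G `<=` <<s G' >> ->
  measurable_fun setT (f : g_sigma_algebraType G -> U) ->
  measurable_fun setT (f : g_sigma_algebraType G' -> U).
Proof.
move=> GG' mf _ A mA; have := mf measurableT A mA; rewrite !setTI.
by apply: smallest_sub => //; exact: smallest_sigma_algebra.
Qed.

End MeasurableMisc.

(** * Deterministic analysis of the algorithm *)

Section GradientTheory.
Context (R : realType) (n : nat).
Implicit Types (f : 'cV[R]_n -> R) (x v s : 'cV[R]_n).

Lemma derive_dotv_grad f x v : differentiable f x ->
  'D_v f x = dotv (grad f x) v.
Proof.
move=> df; rewrite deriveE// dotvE.
have {1}-> : v = \sum_i v i 0 *: delta_mx i 0.
  rewrite [LHS]matrix_sum_delta; apply: eq_bigr => i _.
  by rewrite big_ord1.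
rewrite linear_sum/=; apply: eq_bigr => i _.
by rewrite linearZ/= mulrC mxE deriveE.
Qed.

Lemma is_derive_line f x s (t : R) : differentiable f (x + t *: s) ->
  is_derive t (1 : R) (fun t => f (x + t *: s)) (dotv (grad f (x + t *: s)) s).
Proof.
move=> df; rewrite -(derive_dotv_grad _ df).
have ds : derivable f (x + t *: s) s by exact: diff_derivable.
have E : (fun h : R => h^-1 *: (((fun t => f (x + t *: s)) \o shift t) (h *: 1)
     - f (x + t *: s)))
   = (fun h : R => h^-1 *: ((f \o shift (x + t *: s)) (h *: s) - f (x + t *: s))).
  apply/funext => h /=; congr (_ *: (f _ - _)).
  by rewrite [h *: 1]mulr1 scalerDl addrCA.
by split; rewrite /derivable/derive E.
Qed.

(** Along the segment, [f (x + t *: s)] minus the quadratic [p] has derivative at most 0, by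
    Cauchy-Schwarz and the Lipschitz bound. The mean value theorem then avoids integrating the
    gradient. *)
Lemma descent_lemma f (L : R) x s :
  (forall y, differentiable f y) -> lipschitz_grad L f ->
  f (x + s) <= f x + dotv (grad f x) s + L / 2 * dotv s s.
Proof.
move=> df Lf.
pose g := grad f x.
pose p : {poly R} := (dotv g s)%:P * 'X + (L / 2 * dotv s s)%:P * 'X^2.
pose phi : R -> R := (fun t => f (x + t *: s)) - horner p.
pose dphi t := dotv (grad f (x + t *: s)) s - (deriv p).[t].
have dphiE (t : R) : is_derive t (1 : R) phi (dphi t).
  have h1 := is_derive_line (df (x + t *: s)).
  have h2 : is_derive t (1 : R) (horner p) (deriv p).[t] by exact: is_derive_poly.
  exact: is_deriveB.
have cphi : {within `[0, 1], continuous phi}.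
  by apply: derivable_within_continuous => t _; have [] := dphiE t.
have [t] := MVT_segment ler01 (fun t _ => dphiE t) cphi.
rewrite in_itv/= subr0 mulr1 => /andP[t0 t1] E.
have dphi0 : dphi t <= 0.
  rewrite /dphi /p !(poly.derivE, hornerE)/=.
  have h := dotv_le_norm2 (grad f (x + t *: s) - g) s.
  rewrite dotvDl dotvNl in h.
  have h2 := Lf (x + t *: s) x.
  rewrite addrAC subrr add0r norm2Z// in h2.
  have := ler_wpM2r (norm2_ge0 s) h2.
  rewrite -sqr_norm2; nra.
have phi1 : phi 1 = f (x + s) - (dotv g s + L / 2 * dotv s s).
  rewrite -[LHS]/(f (x + 1 *: s) - p.[1]) scale1r /p !hornerE/=.
  by rewrite ?expr1n ?mulr1.
have phi0 : phi 0 = f x.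
  rewrite -[LHS]/(f (x + 0 *: s) - p.[0]) scale0r addr0 /p !hornerE/=.
  by rewrite ?expr0n ?mulr0 ?addr0 ?subr0.
by move: dphi0; rewrite -E phi1 phi0; lra.
Qed.

End GradientTheory.

(** * The quadratic model and the length of its step *)

Section QuadraticModel.
Context (R : realType).

(** The difference quotient along [v] is [dotv b v + h * r v], so its limit can be read off an exact
    expansion, whatever [r] is. *)
Lemma grad_quadratic n (F : 'cV[R]_n -> R) (x b : 'cV[R]_n) (r : 'cV[R]_n -> R) :
  (forall (h : R) v, F (x + h *: v) = F x + h * dotv b v + h ^+ 2 * r v) ->
  grad F x = b.
Proof.
move=> FE; apply/matrixP => i j; rewrite (ord1 j) mxE.
set v := delta_mx i 0.
have -> : b i 0 = dotv b v.
  rewrite dotvE (bigD1 i)//= mxE !eqxx mulr1 big1 ?addr0// => k ki.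
  by rewrite mxE (negbTE ki) mulr0.
apply/cvg_lim => //.
have : (fun h : R => dotv b v + h * r v) h @[h --> 0^'] --> dotv b v.
  rewrite -[X in _ --> X]addr0 -[X in _ --> _ + X](mul0r (r v)).
  apply: cvg_within_filter; apply: cvgD; first exact: cvg_cst.
  by apply: cvgM; [exact: cvg_id|exact: cvg_cst].
apply: cvg_trans; apply: near_eq_cvg; near=> h.
have h0 : h != 0 by near: h; exact: nbhs_dnbhs_neq.
rewrite /= [h *: v + x]addrC FE /GRing.scale/=.
by field.
Unshelve. all: by end_near.
Qed.

Lemma grad_lhat l d (f : 'cV[R]_d -> R) (x : 'cV[R]_d) (S : 'M[R]_(l, d))
    (B : 'M[R]_d) (a : R) (s : 'cV[R]_l) : B^T = B ->
  grad (lhat f x S B a) s =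
  S *m grad f x + S *m (B *m (S^T *m s) + a^-1 *: (S^T *m s)).
Proof.
move=> BT.
apply: (grad_quadratic (r := fun v =>
  2^-1 * dotv v (S *m B *m S^T *m v) + (2 * a)^-1 * dotv (S^T *m v) (S^T *m v))).
move=> h v; rewrite /lhat /mhat !sqr_norm2.
have SBS u w : dotv u (S *m B *m S^T *m w) = dotv (S^T *m u) (B *m (S^T *m w)).
  by rewrite -!mulmxA [in RHS]dotv_mulmxl trmxK.
have Bsym u w : dotv u (B *m w) = dotv w (B *m u).
  by rewrite dotvC dotv_mulmxl BT.
have Sdot u w : dotv (S *m u) w = dotv u (S^T *m w) by rewrite dotv_mulmxl.
rewrite !SBS !mulmxDr -!scalemxAr !(dotvDl, dotvDr, dotvZl, dotvZr) !Sdot.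
rewrite (dotvC (B *m _)) (Bsym (S^T *m v) (S^T *m s)).
rewrite !(dotvC (S^T *m v)) invfM.
by move: (a^-1) => ai; field.
Qed.

(** The witness is the Frobenius norm; its purpose is to bound the set whose [sup] defines
    [opnorm2]. *)
Lemma norm2_mulmx_le m n (A : 'M[R]_(m, n)) : exists C : R,
  forall v, norm2 (A *m v) <= C * norm2 v.
Proof.
exists (Num.sqrt (\sum_i dotv (row i A)^T (row i A)^T)) => v.
rewrite /norm2 -sqrtrM; last by rewrite sumr_ge0// => i _; exact: dotv_ge0.
rewrite ler_wsqrtr// dotvE mulr_suml ler_sum// => i _.
have -> : (A *m v) i 0 = dotv (row i A)^T v.
  by rewrite mxE dotvE; apply: eq_bigr => j _; rewrite !mxE.
set u := (row i A)^T.
rewrite -!sqr_norm2 -exprMn -expr2 -[leLHS]real_normK ?num_real//.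
rewrite lerXn2r ?nnegrE ?mulr_ge0 ?norm2_ge0// ler_norml dotv_le_norm2 andbT.
have := dotv_le_norm2 (- u) v; rewrite dotvNl.
have -> : norm2 (- u) = norm2 u by rewrite /norm2 dotvNl dotvC dotvNl opprK.
by rewrite lerNl.
Qed.

Lemma norm2_mulmx_opnorm2 m n (A : 'M[R]_(m, n)) (v : 'cV[R]_n) :
  norm2 (A *m v) <= opnorm2 A * norm2 v.
Proof.
have [v0|v0] := eqVneq v 0.
  by rewrite v0 mulmx0 /norm2 !dotv0r sqrtr0 mulr0.
have nv : 0 < norm2 v by rewrite lt0r norm2_eq0 v0 norm2_ge0.
have nV : 0 <= (norm2 v)^-1 by rewrite invr_ge0 ltW.
rewrite -ler_pdivrMr// mulrC -norm2Z// scalemxAr.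
apply: sup_upper_bound; last first.
  by exists ((norm2 v)^-1 *: v) => //=; rewrite norm2Z// mulVf// gt_eqF.
split; first by exists (norm2 (A *m 0)); exists 0 => //=; rewrite /norm2 dotv0r sqrtr0.
have [C hC] := norm2_mulmx_le A; exists `|C| => _ [u /= u1 <-].
apply: le_trans (hC u) _; apply: (@le_trans _ _ (`|C| * norm2 u)).
  by rewrite ler_wpM2r ?norm2_ge0// ler_norm.
by rewrite ler_piMr.
Qed.

(* Testing the residual against [S g] rather than bounding it through the
   operator norm of [S]: only [S^T (S g)] has to be controlled. *)
Lemma step_length_ge l d (S : 'M[R]_(l, d)) (B : 'M[R]_d) (g : 'cV[R]_d)
    (s : 'cV[R]_l) (a Bmax kappa e C : R) :
  0 < a -> 0 <= Bmax -> 0 <= kappa -> 0 <= C -> opnorm2 B <= Bmax ->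
  norm2 (S *m g + S *m (B *m (S^T *m s) + a^-1 *: (S^T *m s)))
    <= kappa * norm2 (S^T *m s) ->
  good_sketch e C S g ->
  (1 - e) * dotv g g
    <= ((C * (Bmax + a^-1) + kappa) * norm2 (S^T *m s)) ^+ 2.
Proof.
move=> a0 Bm0 k0 C0 hB; set t := S^T *m s; set v := B *m t + _ => res.
move=> /andP[h1 h2]; apply: le_trans h1 _.
set y := S *m g in h2 res *.
have aV : 0 <= a^-1 by rewrite invr_ge0 ltW.
have vle : norm2 v <= (Bmax + a^-1) * norm2 t.
  apply: le_trans (norm2D _ _) _; rewrite norm2Z// mulrDl lerD2r.
  by apply: le_trans (norm2_mulmx_opnorm2 _ _) _; rewrite ler_wpM2r ?norm2_ge0.
have rhs0 : 0 <= (C * (Bmax + a^-1) + kappa) * norm2 t.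
  by rewrite mulr_ge0 ?norm2_ge0// addr_ge0// mulr_ge0// addr_ge0.
rewrite -sqr_norm2 lerXn2r ?nnegrE ?norm2_ge0//.
have [y0|y0] := eqVneq y 0; first by rewrite y0 /norm2 dotv0r sqrtr0.
have ny : 0 < norm2 y by rewrite lt0r norm2_eq0 y0 norm2_ge0.
have Sy : norm2 (S^T *m y) <= C * norm2 y.
  rewrite -(ler_pXn2r (_ : (0 < 2)%N)) ?nnegrE ?mulr_ge0 ?norm2_ge0//.
  by rewrite exprMn !sqr_norm2.
rewrite -(ler_pM2l ny) -expr2 sqr_norm2.
have -> : dotv y y = dotv y (y + S *m v) + dotv (- (S^T *m y)) v.
  by rewrite dotvDr dotvNl (dotvC y (S *m v)) dotv_mulmxl (dotvC v) addrK.
have e1 := dotv_le_norm2 y (y + S *m v).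
have e2 := dotv_le_norm2 (- (S^T *m y)) v.
have eN : norm2 (- (S^T *m y)) = norm2 (S^T *m y).
  by rewrite /norm2 dotvNl dotvC dotvNl opprK.
have e3 : norm2 y * norm2 (y + S *m v) <= norm2 y * (kappa * norm2 t).
  by rewrite ler_wpM2l ?norm2_ge0.
have e4 : norm2 (S^T *m y) * norm2 v <= (C * norm2 y) * ((Bmax + a^-1) * norm2 t).
  by rewrite ler_pM ?norm2_ge0.
rewrite eN in e2.
apply: le_trans (lerD (le_trans e1 e3) (le_trans e2 e4)) _.
by rewrite le_eqVlt; apply/orP; left; apply/eqP; ring.
Qed.

Lemma model_decrease_ge l d (f : 'cV[R]_d -> R) (x : 'cV[R]_d) (S : 'M[R]_(l, d))
    (B : 'M[R]_d) (a : R) (s : 'cV[R]_l) :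
  lhat f x S B a s <= lhat f x S B a 0 ->
  dotv (S^T *m s) (S^T *m s) / (2 * a) <= mhat f x S B 0 - mhat f x S B s.
Proof.
by rewrite /lhat !sqr_norm2 mulmx0 dotv0r; rewrite [_^-1 * _]mulrC; lra.
Qed.

Lemma mhat_sub l d (f : 'cV[R]_d -> R) (x : 'cV[R]_d) (S : 'M[R]_(l, d))
    (B : 'M[R]_d) (s : 'cV[R]_l) :
  mhat f x S B 0 - mhat f x S B s =
  - dotv (grad f x) (S^T *m s) - 2^-1 * dotv (S^T *m s) (B *m (S^T *m s)).
Proof.
rewrite /mhat mulmx0 !dotv0r dotv_mulmxl -!mulmxA [in RHS]dotv_mulmxl trmxK.
ring.
Qed.

End QuadraticModel.

Section DeterministicRun.
Context (R : realType).

(* All step sizes lie on the grid [alpha_max gamma1^e]; truncated subtraction of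
   [c] from the exponent is exactly the cap at [alpha_max]. *)
Lemma stepsize_exponent (gamma1 alpha_max alow : R) (c p tau N : nat)
    (alpha : nat -> R) (succ : nat -> bool) :
  0 < gamma1 < 1 -> 0 < alpha_max -> alpha 0%N = alpha_max * gamma1 ^+ p ->
  alpha_max * gamma1 ^+ (p + tau) <= alow ->
  (forall k, (k < N)%N -> alpha k <= alow -> succ k) ->
  (forall k, (k < N)%N -> alpha k.+1 =
    if succ k then Num.min alpha_max (gamma1 ^- c * alpha k)
    else gamma1 * alpha k) ->
  forall k, (k <= N)%N -> exists e : nat,
    [/\ alpha k = alpha_max * gamma1 ^+ e, (e <= p + tau)%N &
        (p + k <= e + c.+1 * \sum_(i < k) succ i)%N].
Proof.
move=> /andP[g0 g1] am0 a0 alowP succP aS.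
have gle i : gamma1 ^+ i <= 1 by rewrite exprn_ile1// ltW.
have gn0 i : gamma1 ^+ i != 0 by rewrite gt_eqF// exprn_gt0.
(* The count holds since a failure raises [e] by 1, while a success lowers it by at most [c] and
   adds [c.+1] on the right; either way the right side grows by at least 1. *)
elim=> [_|k IH kN].
  by exists p; rewrite a0 big_ord0 muln0 !addn0 leq_addr.
have [e [aE ele ke]] := IH (ltnW kN).
rewrite aS// big_ord_recr/=; case: ifPn => sk.
  exists (e - c)%N; split; last 2 first.
  - lia.
  - rewrite -[nat_of_bool true]/1%N mulnDr muln1.
    by move: ke; move: (c.+1 * _)%N => m; lia.
  rewrite aE; have [ce|ec] := leqP c e.
    have -> : gamma1 ^- c * (alpha_max * gamma1 ^+ e) = alpha_max * gamma1 ^+ (e - c).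
      by rewrite -{1}(subnK ce) exprD; field; rewrite gn0.
    by rewrite min_r// ler_piMr// ltW.
  rewrite min_l.
    have -> : (e - c)%N = 0%N by apply/eqP; rewrite subn_eq0 ltnW.
    by rewrite expr0 mulr1.
  have -> : gamma1 ^- c * (alpha_max * gamma1 ^+ e) = alpha_max * (gamma1 ^+ (c - e))^-1.
    by rewrite -{1}(subnK (ltnW ec)) exprD; field; rewrite !gn0.
  by rewrite ler_peMr ?(ltW am0)// invf_ge1 ?exprn_gt0.
exists e.+1; split.
- by rewrite aE exprS mulrCA.
(* At [e = p + tau] the step size is at most [alow], so the iteration succeeds; a failure therefore
   leaves room for [e.+1]. *)
- rewrite ltn_neqAle ele andbT; apply: contra sk => /eqP ek.
  by apply: succP => //; rewrite aE ek.
- by rewrite -[nat_of_bool false]/0%N addn0 addSn addnS.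
Qed.

Variables (l d : nat) (f : 'cV[R]_d.+1 -> R) (L fstar : R).
Hypotheses (df : forall y, differentiable f y) (Lf : lipschitz_grad L f).
Hypothesis fstar_le : forall y, fstar <= f y.

Lemma lipschitz_grad_ge0 : 0 <= L.
Proof.
have := Lf (const_mx 1) 0; rewrite subr0 => h.
have n0 : 0 < norm2 (const_mx 1 : 'cV[R]_d.+1).
  rewrite lt0r norm2_ge0 norm2_eq0 andbT.
  by apply/eqP => /matrixP/(_ 0 0); rewrite !mxE => /eqP; rewrite oner_eq0.
by rewrite -(pmulr_lge0 _ n0) (le_trans _ h)// norm2_ge0.
Qed.

Lemma grad_minimizer y : f y <= fstar -> grad f y = 0.
Proof.
move=> fy; apply/eqP; rewrite -dotv_eq0; apply/eqP/le_anti.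
rewrite dotv_ge0 andbT leNgt; apply/negP => g0.
have L0 := lipschitz_grad_ge0.
(* A gradient step of this length would go below [fstar]; [L + 1] replaces [L], which may be
   zero. *)
pose t : R := (L + 1)^-1.
have t0 : 0 < t by rewrite invr_gt0 ltr_wpDl.
have := descent_lemma y (- t *: grad f y) df Lf.
have := fstar_le (y - t *: grad f y); rewrite -scaleNr.
rewrite !(dotvZl, dotvZr).
set G := dotv _ _ in g0 * => h1 h2.
have Lt : L * t <= 1 by rewrite /t ler_pdivrMr ?ltr_wpDl// mul1r lerDl.
have : t * G * (1 - L * t / 2) <= 0 by move: (le_trans h1 h2) fy; lra.
apply/negP; rewrite -ltNge mulr_gt0 ?mulr_gt0//; lra.
Qed.

Variables (theta alpha_max Bmax kappa epsS C eps : R).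
Hypotheses (theta01 : 0 < theta < 1) (am0 : 0 < alpha_max) (Bm0 : 0 < Bmax).
Hypotheses (kappa0 : 0 <= kappa) (C0 : 0 < C) (epsS1 : epsS < 1) (eps0 : 0 < eps).

Section OneStep.
Variables (x : 'cV[R]_d.+1) (S : 'M[R]_(l, d.+1)) (B : 'M[R]_d.+1) (s : 'cV[R]_l).
Variable a : R.
Hypotheses (a0 : 0 < a) (psdB : psd B) (hB : opnorm2 B <= Bmax).
Hypothesis dec : lhat f x S B a s <= lhat f x S B a 0.
Hypothesis res : norm2 (grad (lhat f x S B a) s) <= kappa * norm2 (S^T *m s).
Let succ := theta * (mhat f x S B 0 - mhat f x S B s) <= f x - f (x + S^T *m s).

Lemma model_decrease_ge0 : 0 <= mhat f x S B 0 - mhat f x S B s.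
Proof.
apply: le_trans (model_decrease_ge dec).
by rewrite divr_ge0 ?dotv_ge0// mulr_ge0// ltW.
Qed.

(** By the descent lemma and [psd B], the actual decrease is at least [D - L / 2 * q]. The
    regularisation gives [D >= q / (2 * a)], and for such [a] the loss [L / 2 * q] is at most
    [(1 - theta) * D]. *)
Lemma small_step_success : a <= (1 - theta) / (L + Bmax) -> succ.
Proof.
move=> ale; rewrite /succ.
have L0 := lipschitz_grad_ge0.
have h1 := model_decrease_ge dec.
have h2 := mhat_sub f x S B s.
have h3 := psdB.2 (S^T *m s).
have h4 := descent_lemma x (S^T *m s) df Lf.
set D := mhat f x S B 0 - _ in h1 h2 *.
set q := dotv (S^T *m s) (S^T *m s) in h1 h4.
have q0 : 0 <= q by exact: dotv_ge0.
have LB : 0 < L + Bmax by rewrite ltr_wpDl.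
have h5 : L / 2 * q <= (1 - theta) * D.
  have h6 : (1 - theta) * (q / (2 * a)) <= (1 - theta) * D.
    by rewrite ler_wpM2l// subr_ge0; case/andP: theta01 => _ /ltW.
  apply: le_trans h6.
  have -> : (1 - theta) * (q / (2 * a)) = (1 - theta) / a / 2 * q.
    by field; rewrite gt_eqF.
  rewrite ler_wpM2r// ler_pM2r// ler_pdivlMr//.
  apply: le_trans (_ : (L + Bmax) * a <= _).
    by rewrite ler_wpM2r ?(ltW a0)// lerDl ltW.
  by rewrite mulrC -ler_pdivlMr.
lra.
Qed.

(** The step size enters twice: its lower bound [amin] through the residual estimate for the step
    length, its upper bound [alpha_max] through [D >= q / (2 * a)]. *)
Lemma good_step_decrease (amin : R) :
  0 < amin <= a -> a <= alpha_max -> succ -> good_sketch epsS C S (grad f x) ->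
  eps < norm2 (grad f x) ->
  theta * (1 - epsS) * eps ^+ 2 /
    (2 * alpha_max * (C * (Bmax + amin^-1) + kappa) ^+ 2)
  <= f x - f (x + S^T *m s).
Proof.
move=> /andP[amin0 amin_a] aam hs gs ge; apply: le_trans hs.
have [t0 t1] := andP theta01.
have h1 := model_decrease_ge dec.
set D := mhat f x S B 0 - _ in h1 *.
have res' := res; rewrite (grad_lhat f x S a s psdB.1) in res'.
have h2 := step_length_ge a0 (ltW Bm0) kappa0 (ltW C0) hB res' gs.
rewrite exprMn sqr_norm2 -[dotv (grad f x) _]sqr_norm2 in h2.
set q := dotv (S^T *m s) (S^T *m s) in h1 h2.
have q0 : 0 <= q by exact: dotv_ge0.
set W := (C * (Bmax + amin^-1) + kappa) ^+ 2.
have W1 : 0 < C * (Bmax + amin^-1) + kappa.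
  by rewrite ltr_wpDr// mulr_gt0// addr_gt0// invr_gt0.
have W0 : 0 < W by rewrite exprn_gt0.
have h3 : (1 - epsS) * eps ^+ 2 <= W * q.
  apply: (@le_trans _ _ ((1 - epsS) * norm2 (grad f x) ^+ 2)).
    rewrite ler_wpM2l ?subr_ge0 ?(ltW epsS1)//.
    by rewrite lerXn2r ?nnegrE ?norm2_ge0 ?ltW.
  apply: le_trans h2 _; rewrite ler_wpM2r// lerXn2r// ?nnegrE.
  - by rewrite addr_ge0// mulr_ge0 ?(ltW C0)// addr_ge0 ?(ltW Bm0)// invr_ge0 ltW.
  - by rewrite addr_ge0// mulr_ge0 ?(ltW C0)// addr_ge0 ?(ltW Bm0)// invr_ge0 ltW.
  rewrite lerD2r ler_wpM2l ?(ltW C0)// lerD2l lef_pV2 ?posrE//.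
have h4 : q / (2 * alpha_max) <= D.
  apply: le_trans h1; rewrite ler_wpM2l// lef_pV2 ?posrE ?mulr_gt0//.
  by rewrite ler_pM2l.
apply: (@le_trans _ _ (theta * (q / (2 * alpha_max)))); last by rewrite ler_pM2l.
have -> : theta * (q / (2 * alpha_max)) = theta * (W * q) / (2 * alpha_max * W).
  by field; rewrite !gt_eqF.
rewrite ler_pM2r ?invr_gt0 ?mulr_gt0//.
by rewrite -(mulrA theta (1 - epsS)) ler_pM2l.
Qed.

End OneStep.

End DeterministicRun.

Lemma leq_sum_and (a b : nat -> bool) k :
  (\sum_(i < k) a i + \sum_(i < k) b i <= \sum_(i < k) (a i && b i) + k)%N.
Proof.
elim: k => [|k IH]; first by rewrite !big_ord0.
rewrite !big_ord_recr/= addnACA -addn1 [leqRHS]addnACA leq_add//.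
by case: (a k); case: (b k).
Qed.

(** [NT], [NS] and [TS] stand for the good, the successful and the good successful iterations.
    Counting yields the fraction [1 / (c + 1)] of successes, which is at least [c / (c + 1) ^ 2]. *)
Lemma good_success_count (R : realType) (q delta : R) (N NT NS TS c tau : nat) :
  (NT + NS <= TS + N)%N -> (N <= tau + c.+1 * NS)%N ->
  (1 - delta) * (q * N%:R) <= NT%:R ->
  (q * (1 - delta) - 1 + c%:R / (c%:R + 1) ^+ 2) * N%:R - tau%:R / (1 + c%:R)
    <= TS%:R.
Proof.
move=> both hc hgood.
have hcR : N%:R <= tau%:R + (c%:R + 1) * NS%:R :> R.
  by rewrite natr1 -natrM -natrD ler_nat.
have hbR : NT%:R + NS%:R <= TS%:R + N%:R :> R by rewrite -!natrD ler_nat.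
have c1 : 0 < c%:R + 1 :> R by rewrite natr1 ltr0n.
have hNS : N%:R / (c%:R + 1) - tau%:R / (c%:R + 1) <= NS%:R :> R.
  by rewrite -mulrBl ler_pdivrMr// mulrC lerBlDl.
have hcc : c%:R / (c%:R + 1) ^+ 2 * N%:R <= N%:R / (c%:R + 1) :> R.
  rewrite mulrC ler_wpM2l// ler_pdivrMr ?exprn_gt0// expr2 mulrA mulVf ?mul1r ?gt_eqF//.
  by rewrite lerDl.
rewrite (addrC 1 c%:R) [X in X - _]mulrDl; move: hNS hcc hbR hgood {hcR hc both c1}.
set u := N%:R / _; set v := tau%:R / _; set z := _ / _ * N%:R.
lra.
Qed.

(** * The run along a single outcome *)

Section Pathwise.
Context (R : realType) (l d : nat).
Variables (f : 'cV[R]_d.+1 -> R) (L fstar : R).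
Hypotheses (df : forall y, differentiable f y) (Lf : lipschitz_grad L f).
Hypothesis fstar_le : forall y, fstar <= f y.
Variables (gamma1 theta alpha_max Bmax kappa epsS C eps : R) (c p tau N : nat).
Hypotheses (g01 : 0 < gamma1 < 1) (theta01 : 0 < theta < 1) (am0 : 0 < alpha_max).
Hypotheses (Bm0 : 0 < Bmax) (kappa0 : 0 <= kappa) (C0 : 0 < C) (epsS1 : epsS < 1).
Hypothesis eps0 : 0 < eps.
Variables (x : nat -> 'cV[R]_d.+1) (alpha : nat -> R) (S : nat -> 'M[R]_(l, d.+1)).
Variables (B : nat -> 'M[R]_d.+1) (s : nat -> 'cV[R]_l).
Hypothesis alpha0 : alpha 0%N = alpha_max * gamma1 ^+ p.
Hypothesis tauP : alpha_max * gamma1 ^+ (p + tau) <= (1 - theta) / (L + Bmax).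
Hypothesis hB : forall k, (k < N)%N -> psd (B k) /\ opnorm2 (B k) <= Bmax.
Hypothesis hres : forall k, (k < N)%N ->
  norm2 (grad (lhat f (x k) (S k) (B k) (alpha k)) (s k))
    <= kappa * norm2 ((S k)^T *m s k).
Hypothesis hdec : forall k, (k < N)%N ->
  lhat f (x k) (S k) (B k) (alpha k) (s k) <= lhat f (x k) (S k) (B k) (alpha k) 0.
Let succ k := theta * (mhat f (x k) (S k) (B k) 0 - mhat f (x k) (S k) (B k) (s k))
  <= f (x k) - f (x k + (S k)^T *m s k).
Hypothesis hupd : forall k, (k < N)%N ->
  if succ k then x k.+1 = x k + (S k)^T *m s k /\
                 alpha k.+1 = Num.min alpha_max (gamma1 ^- c * alpha k)
  else x k.+1 = x k /\ alpha k.+1 = gamma1 * alpha k.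
Let good k := good_sketch epsS C (S k) (grad f (x k)).

Lemma success_if_small k : (k < N)%N -> 0 < alpha k ->
  alpha k <= (1 - theta) / (L + Bmax) -> succ k.
Proof.
move=> kN ak0 ak.
by apply: (small_step_success df Lf theta01 Bm0 ak0 (hB kN).1 (hdec kN)).
Qed.

Lemma alpha_gt0 k : (k <= N)%N -> 0 < alpha k.
Proof.
have [g0 _] := andP g01.
elim: k => [_|k IH kN]; first by rewrite alpha0 mulr_gt0// exprn_gt0.
have := hupd kN; case: ifP => _ [_ ->].
  by rewrite lt_min am0 mulr_gt0 ?invr_gt0 ?exprn_gt0// IH// ltnW.
by rewrite mulr_gt0// IH// ltnW.
Qed.

Lemma run_exponent k : (k <= N)%N -> exists e : nat,
    [/\ alpha k = alpha_max * gamma1 ^+ e, (e <= p + tau)%N &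
        (p + k <= e + c.+1 * \sum_(i < k) succ i)%N].
Proof.
apply: (stepsize_exponent g01 am0 alpha0 tauP).
- by move=> i iN; apply: success_if_small => //; exact/alpha_gt0/ltnW.
- by move=> i iN; have := hupd iN; case: ifP => _ [].
Qed.

(** This is the argument of [h] in the theorem. [run_exponent] keeps the exponent at most [p + tau];
    the additional [c] only lowers [amin]. *)
Let amin := alpha_max * gamma1 ^+ (p + (c + tau)).
Let h := theta * (1 - epsS) * eps ^+ 2 /
    (2 * alpha_max * (C * (Bmax + amin^-1) + kappa) ^+ 2).

(** The other iterations never increase [f]: a failure keeps the iterate, and a success decreases
    [f] by at least [theta] times a nonnegative model decrease. *)
Lemma run_decrease_bound k : (k <= N)%N ->
  (forall i, (i <= N)%N -> eps < norm2 (grad f (x i))) ->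
  h * (\sum_(i < k) (good i && succ i))%:R <= f (x 0%N) - f (x k).
Proof.
move=> kN ge; have [g0 g1] := andP g01.
elim: k kN => [_|k IH kN]; first by rewrite big_ord0 mulr0 subrr.
have ak0 := alpha_gt0 (ltnW kN).
rewrite big_ord_recr/= natrD mulrDr.
have -> : f (x 0%N) - f (x k.+1) = f (x 0%N) - f (x k) + (f (x k) - f (x k.+1)).
  by rewrite addrA subrK.
rewrite lerD ?IH//; first exact: ltnW.
have := hupd kN; case: ifPn => sk [-> _]; last by rewrite andbF mulr0 subrr.
rewrite andbT; case: (boolP (good k)) => gk; last first.
  rewrite mulr0; apply: le_trans sk; rewrite mulr_ge0 ?(ltW (andP theta01).1)//.
  exact: (model_decrease_ge0 ak0 (hdec kN)).
rewrite mulr1.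
have [e [aE ele _]] := run_exponent (ltnW kN).
apply: (good_step_decrease theta01 am0 Bm0 kappa0 C0 epsS1 eps0 ak0
  (hB kN).1 (hB kN).2 (hdec kN) (hres kN) _ _ sk gk).
- rewrite mulr_gt0 ?exprn_gt0//= aE ler_pM2l//.
  by rewrite ler_wiXn2l ?(ltW g1) ?(ltW g0)// (leq_trans ele)// leq_add2l leq_addl.
- by rewrite aE ler_piMr ?exprn_ile1 ?(ltW g1) ?(ltW g0) ?(ltW am0).
- exact/ge/ltnW.
Qed.

Lemma run_reaches_eps (q delta : R) :
  (f (x 0%N) - fstar) / h + tau%:R / (1 + c%:R)
    <= (q * (1 - delta) - 1 + c%:R / (c%:R + 1) ^+ 2) * N%:R ->
  (1 - delta) * (q * N%:R) <= (\sum_(i < N) good i)%:R ->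
  exists2 k, (k <= N)%N & norm2 (grad f (x k)) <= eps.
Proof.
move=> hN hgood; apply: contrapT => hno.
have ge i : (i <= N)%N -> eps < norm2 (grad f (x i)).
  by move=> iN; rewrite ltNge; apply/negP => h1; apply: hno; exists i.
have hdecr := run_decrease_bound (leqnn N) ge.
have [e [_ ele hcount]] := run_exponent (leqnn N).
have both := leq_sum_and good succ N.
set TS := (\sum_(i < N) (good i && succ i))%N in both hdecr.
have hc : (N <= tau + c.+1 * \sum_(i < N) succ i)%N.
  by rewrite -(leq_add2l p) addnA (leq_trans hcount)// leq_add2r.
have h0 : 0 < h.
  have [t0 t1] := andP theta01; have [g0 _] := andP g01.
  have a0 : 0 < amin by rewrite mulr_gt0// exprn_gt0.
  have W0 : 0 < C * (Bmax + amin^-1) + kappa.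
    by rewrite ltr_wpDr// mulr_gt0// addr_gt0// invr_gt0.
  by rewrite /h divr_gt0// ?mulr_gt0 ?exprn_gt0 ?subr_gt0.
have hTS : (f (x 0%N) - fstar) / h <= TS%:R.
  apply: le_trans (good_success_count both hc hgood).
  by rewrite lerBrDr.
(* The bound on [N] is not strict, so counting alone gives no contradiction. It comes from the
   vanishing gradient at [x N], since [ge] includes the index [N]. *)
have hfN : f (x N) <= fstar.
  have h1 : f (x 0%N) - fstar <= h * TS%:R.
    by rewrite (mulrC h); move: hTS; rewrite (ler_pdivrMr _ _ h0).
  by have := le_trans h1 hdecr; rewrite lerD2l lerN2.
have := ge N (leqnn N); rewrite (grad_minimizer df Lf fstar_le hfN).
by rewrite /norm2 dotv0r sqrtr0 ltNge ltW.
Qed.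

End Pathwise.

(** * Measurability of the iterates and conclusion *)

Section HistoryMeasurable.
Context d0 (T : measurableType d0) (R : realType) (P : probability T R).
Context (l d : nat).
Variables (f : 'cV[R]_d.+1 -> R).
Hypotheses (df : forall y, differentiable f y) (cgf : continuous (grad f)).
Variables (gamma1 gamma2 theta alpha_max alpha0 Bmax kappaT : R) (x0 : 'cV[R]_d.+1).
Variable N : nat.
Variables (S : nat -> 'M[{RV P >-> R}]_(l, d.+1)) (B : nat -> 'M[{RV P >-> R}]_d.+1).
Variables (shat : nat -> 'cV[{RV P >-> R}]_l).
Variables (x : nat -> T -> 'cV[R]_d.+1) (alpha : nat -> T -> R).
Hypothesis run : rsqr_run f gamma1 gamma2 theta alpha_max alpha0 Bmax kappaT x0 N
  S B shat x alpha.

Definition history_generator (k : nat) : set (set T) :=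
  \bigcup_(i in [set i | (i < k)%N])
        (entry_events (S i) `|` entry_events (B i) `|` entry_events (shat i)).

Local Notation HT k := (g_sigma_algebraType (history_generator k)).

Lemma history_measurable k : <<s history_generator k >> `<=` measurable.
Proof.
apply: smallest_sub (@sigma_algebra_measurable _ T) _ => A [i _ [[|]|]] hA;
  by apply: entry_events_measurable; exact: sub_gen_smallest hA.
Qed.

Lemma measurable_mx_sub_entry m n (X : 'M[{RV P >-> R}]_(m, n)) (G : set (set T)) :
  entry_events X `<=` G ->
  measurable_mx (mxval X : g_sigma_algebraType G -> 'M[R]_(m, n)).
Proof.
move=> XG i j.
apply: (@measurable_fun_sub_sigma _ _ _ _ (entry_events X)).
  exact: subset_trans XG (@sub_gen_smallest _ _ _).
exact: measurable_mx_entry_events.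
Qed.

Lemma measurable_grad_comp d' (U : measurableType d') (X : U -> 'cV[R]_d.+1) :
  measurable_mx X -> measurable_mx (fun w => grad f (X w)).
Proof.
move=> mX i j.
apply: (@measurable_continuous_mx _ _ _ _ (fun y => grad f y i j)) => // y.
by apply: (@continuous_comp _ _ _ (grad f) (fun M => M i j)); [exact: cgf|exact: coord_continuous].
Qed.

Lemma measurable_f_comp d' (U : measurableType d') (X : U -> 'cV[R]_d.+1) :
  measurable_mx X -> measurable_fun setT (fun w => f (X w)).
Proof.
by apply: measurable_continuous_mx => y; exact/differentiable_continuous/df.
Qed.

(** The history at [k] covers iterations before [k] only, so the draws of iteration [k], which
    produce the iterate [k.+1], are in the history at [k.+1]. The success test is a measurable
    function of them and of [x k]. *)
Lemma iterates_measurable k : (k <= N)%N ->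
  measurable_mx (x k : HT k -> 'cV[R]_d.+1) /\
  measurable_fun setT (alpha k : HT k -> R).
Proof.
elim: k => [_|k IH kN].
  split.
    move=> i j; rewrite (_ : (fun w => x 0%N w i j) = cst (x0 i j)).
      exact: measurable_cst.
    by apply/funext => w; rewrite (run_x0 run).
  rewrite (_ : alpha 0%N = cst alpha0); first exact: measurable_cst.
  by apply/funext => w; rewrite (run_alpha0 run).
have [mx ma] := IH (ltnW kN).
have sub : history_generator k `<=` <<s history_generator k.+1 >>.
  apply: subset_trans (@sub_gen_smallest _ _ _) => A [i /= ik hA].
  by exists i => //=; exact: ltnW.
have mx' : measurable_mx (x k : HT k.+1 -> 'cV[R]_d.+1).
  by move=> i j; exact: measurable_fun_sub_sigma sub (mx i j).
have ma' : measurable_fun setT (alpha k : HT k.+1 -> R).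
  exact: measurable_fun_sub_sigma sub ma.
have mS : measurable_mx (mxval (S k) : HT k.+1 -> 'M[R]_(l, d.+1)).
  by apply: measurable_mx_sub_entry => A hA; exists k; [exact: ltnSn|left; left].
have mB : measurable_mx (mxval (B k) : HT k.+1 -> 'M[R]_d.+1).
  by apply: measurable_mx_sub_entry => A hA; exists k; [exact: ltnSn|left; right].
have ms : measurable_mx (mxval (shat k) : HT k.+1 -> 'cV[R]_l).
  by apply: measurable_mx_sub_entry => A hA; exists k; [exact: ltnSn|right].
have mSt := measurable_mx_tr mS.
have mstep : measurable_mx (fun w : HT k.+1 =>
    (mxval (S k) w)^T *m mxval (shat k) w) by exact: measurable_mx_mul.
have mg := measurable_grad_comp mx'.
have mxs := measurable_mx_add mx' mstep.
have mm (s : HT k.+1 -> 'cV[R]_l) : measurable_mx s -> measurable_fun setT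
    (fun w : HT k.+1 => mhat f (x k w) (mxval (S k) w) (mxval (B k) w) (s w)).
  move=> mss; apply: measurable_funD.
    apply: measurable_funD; first exact: measurable_f_comp.
    by apply: measurable_dotv => //; exact: measurable_mx_mul.
  apply: measurable_funM => //; apply: measurable_dotv => //.
  apply: measurable_mx_mul => //; apply: measurable_mx_mul => //.
  exact: measurable_mx_mul.
pose succ (w : HT k.+1) :=
  theta * (mhat f (x k w) (mxval (S k) w) (mxval (B k) w) 0 -
           mhat f (x k w) (mxval (S k) w) (mxval (B k) w) (mxval (shat k) w))
  <= f (x k w) - f (x k w + (mxval (S k) w)^T *m mxval (shat k) w).
have msucc : measurable_fun setT succ.
  apply: measurable_fun_ler.
    apply: measurable_funM => //; apply: measurable_funB; last exact: mm.
    by apply: mm => i j; exact: measurable_cst.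
  by apply: measurable_funB; exact: measurable_f_comp.
split.
  have := measurable_mx_if msucc mxs mx'.
  congr measurable_mx; apply/funext => w.
  by have := run_update run w kN; cbv zeta; case: ifPn => sw [-> _]; rewrite /succ ?sw ?(negbTE sw).
have mmin : measurable_fun setT (fun w : HT k.+1 => Num.min alpha_max (gamma2 * alpha k w)).
  by apply: measurable_minr => //; exact: measurable_funM.
have mg1 : measurable_fun setT (fun w : HT k.+1 => gamma1 * alpha k w).
  exact: measurable_funM.
have := measurable_fun_ifT msucc mmin mg1.
congr (measurable_fun _ _); apply/funext => w /=.
by have := run_update run w kN; cbv zeta; case: ifPn => sw [_ ->]; rewrite /succ ?sw ?(negbTE sw).
Qed.

Variables (epsS C : R).
Definition good_iteration (k : nat) (w : T) : bool :=
  good_sketch epsS C (mxval (S k) w) (grad f (x k w)).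

Lemma good_iteration_measurable k : (k < N)%N ->
  measurable_fun setT (good_iteration k : HT k.+1 -> bool).
Proof.
move=> kN; have [mx _] := iterates_measurable (ltnW kN).
apply: measurable_good_sketch.
  by apply: measurable_mx_sub_entry => A hA; exists k; [exact: ltnSn|left; left].
apply: measurable_grad_comp => i j.
apply: measurable_fun_sub_sigma (mx i j).
apply: subset_trans (@sub_gen_smallest _ _ _) => A [n /= nk hA].
by exists n => //=; exact: ltnW.
Qed.

(** These level sets are the past events to which the concentration argument applies its bound. *)
Lemma count_good_history k j : (k <= N)%N ->
  <<s history_generator k >> [set w | count_good good_iteration k w = j].
Proof.
move=> kN.
have mc : measurable_fun setT ((fun w => \sum_(i < k) (good_iteration i w : nat)%:R)
    : HT k -> R).
  apply: measurable_sum => i.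
  have mi : measurable_fun setT (good_iteration i : HT k -> bool).
    apply: measurable_fun_sub_sigma (good_iteration_measurable _).
      apply: subset_trans (@sub_gen_smallest _ _ _) => A [n /= nk hA].
      by exists n => //=; exact: leq_trans nk (ltn_ord i).
    exact: leq_trans (ltn_ord i) kN.
  rewrite (_ : (fun w => _) = (fun w => if good_iteration i w then 1 else 0)).
    by apply: measurable_fun_ifT.
  by apply/funext => w; case: good_iteration.
have := mc measurableT [set j%:R] (measurable_set1 _); rewrite setTI.
congr (<<s _ >> _); apply/seteqP; split => w /=; rewrite /count_good -natr_sum.
  by move=> /eqP; rewrite eqr_nat => /eqP.
by move=> ->.
Qed.

End HistoryMeasurable.

(** If no index up to [N] qualifies, the infimum is at least [N.+1]; this includes the empty set,
    whose infimum is infinite. *)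
Lemma N_eps_le (R : realType) d (T : Type) (f : 'cV[R]_d -> R)
    (x : nat -> T -> 'cV[R]_d) (eps : R) (w : T) (N : nat) :
  (N_eps f x eps w <= N%:R%:E)%E <->
  exists2 k, (k <= N)%N & norm2 (grad f (x k w)) <= eps.
Proof.
split=> [hN|[k kN hk]]; last first.
  apply: (@le_trans _ _ k%:R%:E%E); last by rewrite lee_fin ler_nat.
  by apply: ereal_inf_lbound; exists k.
apply: contrapT => hno; move: hN; apply/negP; rewrite -ltNge.
apply: (@lt_le_trans _ _ N.+1%:R%:E%E); first by rewrite lte_fin ltr_nat.
apply/ereal_infP => _ [k hk <-]; rewrite lee_fin ler_nat ltnNge.
by apply/negP => kN; apply: hno; exists k.
Qed.

(** Since [ln b < 0], rounding the exponent up makes the power smaller; [y <= 1] makes the exponent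
    a natural number. *)
Lemma ceil_log_base (R : realType) (b y : R) : 0 < b < 1 -> 0 < y <= 1 ->
  exists2 n : nat, Num.ceil (log_base b y) = n%:Z & b ^+ n <= y.
Proof.
move=> /andP[b0 b1] /andP[y0 y1].
have lb : ln b < 0 by rewrite ln_lt0// b0.
have ly : ln y <= 0 by rewrite ln_le0.
have q0 : 0 <= log_base b y by rewrite /log_base ler_ndivlMr// mul0r.
have t0 : 0 <= Num.ceil (log_base b y).
  by rewrite ceil_ge0 (lt_le_trans _ q0)// ltrN10.
case: (Num.ceil (log_base b y)) t0 (ceil_ge (log_base b y)) => // n _ hn.
exists n => //.
rewrite -[y in leRHS]lnK ?posrE// -[b]lnK ?posrE// -expRM_natl ler_expR.
by rewrite -ler_ndivrMr//.
Qed.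

Lemma le_sqr_addr1 (R : realFieldType) (z : R) : 0 <= z -> z <= (z + 1) ^+ 2.
Proof. by move=> z0; nra. Qed.

Theorem theorem4p5p1 (R : realType)
  (disp : measure_display) (T : measurableType disp) (P : probability T R)
  (l d : nat) (hl : (0 < l)%N) (hld : (l <= d)%N)
  (* objective *)
  (f : 'cV[R]_d -> R) (L fstar : R)
  (hf : continuously_differentiable f) (hL : lipschitz_grad L f)
  (hfstar : (exists y, f y = fstar) /\ forall y, fstar <= f y)
  (* algorithm parameters *)
  (gamma1 theta alpha_max Bmax kappaT : R) (c p : nat) (x0 : 'cV[R]_d)
  (hgamma1 : 0 < gamma1 < 1) (hc : (0 < c)%N) (htheta : 0 < theta < 1)
  (halpha_max : 0 < alpha_max) (hBmax : 0 < Bmax) (hkappaT : 0 <= kappaT)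
  (hp : (0 < p)%N)
  (* accuracy and probability parameters *)
  (eps deltaS2 epsS delta1 : R)
  (heps : 0 < eps) (hdeltaS2 : 0 < deltaS2) (hepsS : 0 < epsS < 1)
  (hdelta1 : 0 < delta1) (N : nat)
  (S : nat -> 'M[{RV P >-> R}]_(l, d)) (B : nat -> 'M[{RV P >-> R}]_d)
  (shat : nat -> 'cV[{RV P >-> R}]_l)
  (x : nat -> T -> 'cV[R]_d) (alpha : nat -> T -> R) :
  let gamma2 : R := gamma1 ^- c in
  let alpha0 : R := alpha_max * gamma1 ^+ p in
  let deltaS : R := expR (- (l%:R * epsS ^+ 2 / 4)) + deltaS2 in
  let rate : R :=
    ((1 - deltaS) * (1 - delta1) - 1 + c%:R / (c%:R + 1) ^+ 2)^-1 in
  let alpha_low : R := (1 - theta) / (L + Bmax) in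
  let tau : int :=
    Num.ceil (log_base gamma1 (Num.min (alpha_low / alpha0) (1 / gamma2))) in
  let h (e a : R) : R :=
    theta * (1 - epsS) * e ^+ 2 /
    (2 * alpha_max *
     ((1 + Num.sqrt (d%:R / l%:R) + Num.sqrt (2 * ln (1 / deltaS2) / l%:R))
        * (Bmax + a^-1) + kappaT) ^+ 2) in
  deltaS < c%:R / (c%:R + 1) ^+ 2 ->
  0 < rate ->
  rsqr_run f gamma1 gamma2 theta alpha_max alpha0 Bmax kappaT x0 N
    S B shat x alpha ->
  (forall k, (k < N)%N -> scaled_gaussian (S k)) ->
  rate * ((f x0 - fstar) / h eps (alpha0 * gamma1 ^ (c%:Z + tau))
          + tau%:~R / (1 + c%:R)) <= N%:R ->
  ((1 - expR (- (delta1 ^+ 2 / 2 * (1 - deltaS) * N%:R)))%:E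
    <= P [set w | N_eps f x eps w <= N%:R%:E])%E.
Proof.
move=> gamma2 alpha0 deltaS rate alpha_low tau h hdS hrate run hS hN.
destruct l as [|l']; first by []; destruct d as [|d']; first by [].
have [df cgf] := hf.
have [g0 g1] := andP hgamma1.
have [t0 t1] := andP htheta.
have [e0 e1] := andP hepsS.
have [[ymin fymin] fstar_le] := hfstar.
have L0 := lipschitz_grad_ge0 hL.
pose X := (1 - deltaS) * (1 - delta1) - 1 + c%:R / (c%:R + 1) ^+ 2.
have X0 : 0 < X by rewrite -invr_gt0.
have c1 : 0 < c%:R + 1 :> R by rewrite natr1 ltr0n.
have dS1 : deltaS < 1.
  apply: (lt_le_trans hdS); rewrite ler_pdivrMr ?exprn_gt0// mul1r.
  exact: le_sqr_addr1.
have dS0 : 0 <= deltaS by rewrite addr_ge0 ?expR_ge0// ltW.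
have d2 : 0 < deltaS2 <= 1.
  rewrite hdeltaS2 (le_trans _ (ltW dS1))// /deltaS lerDr expR_ge0//.
have a00 : 0 < alpha0 by rewrite mulr_gt0// exprn_gt0.
have al0 : 0 < alpha_low by rewrite divr_gt0 ?subr_gt0// ltr_wpDl.
pose y := Num.min (alpha_low / alpha0) (1 / gamma2).
(* The second argument of the minimum, [1 / gamma2 = gamma1 ^+ c], keeps [y] at most 1, so that
   [tau] is nonnegative. *)
have y01 : 0 < y <= 1.
  rewrite lt_min divr_gt0// ge_min div1r invrK exprn_gt0//=.
  by rewrite exprn_ile1 ?orbT// ltW.
have [n tauE yn] := ceil_log_base hgamma1 y01.
rewrite -/y -/tau in tauE.
have tauP : alpha_max * gamma1 ^+ (p + n) <= (1 - theta) / (L + Bmax).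
  rewrite exprD mulrA -/alpha0 mulrC -ler_pdivlMr//.
  by apply: (le_trans yn); rewrite ge_min lexx.
pose C : R := sketch_bound l'.+1 d'.+1 deltaS2.
have C0 : 0 < C.
  by rewrite /C /sketch_bound -addrA ltr_pwDl// addr_ge0 ?sqrtr_ge0.
have hN' : (f x0 - fstar) / (theta * (1 - epsS) * eps ^+ 2 /
    (2 * alpha_max * (C * (Bmax + (alpha_max * gamma1 ^+ (p + (c + n)))^-1)
       + kappaT) ^+ 2)) + n%:R / (1 + c%:R) <= X * N%:R.
  rewrite -ler_pdivrMl//.
  have -> : alpha_max * gamma1 ^+ (p + (c + n)) = alpha0 * gamma1 ^ (c%:Z + tau).
    by rewrite tauE -PoszD -exprnP exprD mulrA.
  by move: hN; rewrite tauE.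
pose G k := good_iteration f S x epsS C k.
pose past k : set (set T) := <<s history_generator S B shat k >>.
have pastm k : past k `<=` measurable by exact: history_measurable.
have mG k : (k < N)%N -> measurable [set w | G k w].
  move=> kN; apply: (pastm k.+1).
  have := measurable_bool_set (good_iteration_measurable df cgf run epsS C kN).
  exact.
have pc k j : (k < N)%N -> past k [set w | count_good G k w = j].
  by move=> kN; apply: (count_good_history df cgf run epsS C j (ltnW kN)).
have bl k H : (k < N)%N -> past k H ->
    (P ([set w | ~~ G k w] `&` H) <= deltaS%:E * P H)%E.
  move=> kN pH.
  have [mx _] := iterates_measurable df cgf run (ltnW kN).
  apply: (@bad_sketch_given_past _ _ _ P l' d' (S k) (history_generator S B shat k)
    (fun w => grad f (x k w)) H epsS deltaS2) => //.
  - exact: history_measurable.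
  - exact: (run_draw run).
  - exact: measurable_grad_comp cgf _ _ _ mx.
  - exact: hS.
have dS01 : 0 <= deltaS <= 1 by rewrite dS0 ltW.
have ch := conditional_chernoff dS01 mG pc bl (ltW hdelta1).
set bad := [set w | _] in ch.
set E := [set w | _].
have EE : E = [set w | exists2 k, (k <= N)%N & norm2 (grad f (x k w)) <= eps].
  by apply/seteqP; split => w /=; rewrite /E/= N_eps_le.
have mGT k : (k < N)%N -> measurable_fun setT (G k).
  by move=> kN; apply: (measurable_fun_bool true); rewrite setTI; exact: mG.
have mE : measurable E.
  rewrite EE (_ : [set w | _] = \bigcup_(k in [set k | (k <= N)%N])
    [set w | norm2 (grad f (x k w)) <= eps]); last first.
    by apply/seteqP; split => w /= [k kN hk]; exists k.
  apply: bigcup_measurable => k /= kN.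
  have [mx _] := iterates_measurable df cgf run kN.
  apply: history_measurable.
  rewrite (_ : [set w | _] = [set w | dotv (grad f (x k w)) (grad f (x k w)) <= eps ^+ 2]).
    apply: (measurable_bool_set (T := g_sigma_algebraType (history_generator S B shat k))).
    apply: measurable_fun_ler => //.
    by apply: measurable_dotv; exact: (measurable_grad_comp cgf mx).
  by apply/seteqP; split => w /=;
    rewrite -sqr_norm2 ler_pXn2r ?nnegrE ?norm2_ge0 ?(ltW heps).
have mbad : measurable bad.
  apply: measurable_bool_set; apply: measurable_fun_ltr => //.
  rewrite (_ : (fun w => _) = (fun w => \sum_(i < N) (if G i w then 1 else 0)%:R)).
    apply: measurable_sum => i.
    rewrite (_ : (fun w => _) = (fun w => if G i w then 1 else 0)).
      by apply: measurable_fun_ifT => //; exact: mGT.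
    by apply/funext => w; case: (G i w).
  by apply/funext => w; rewrite natr_sum.
(* Off the bad event there are enough good iterations, and the pathwise result applies to the
   outcome [w] with [q = 1 - deltaS]. *)
have sub : ~` bad `<=` E.
  rewrite EE => w /= /negP; rewrite -leNgt => hw.
  apply: (@run_reaches_eps R l'.+1 d' f L fstar df hL fstar_le gamma1 theta
    alpha_max Bmax kappaT epsS C eps c p n N hgamma1 htheta halpha_max hBmax hkappaT
    C0 e1 heps (x ^~ w) (alpha ^~ w) (fun k => mxval (S k) w) (fun k => mxval (B k) w)
    (fun k => mxval (shat k) w) _ tauP _ _ _ _ (1 - deltaS) delta1 _ hw).
  - exact: (run_alpha0 run).
  - by move=> k kN; exact: (run_B run).
  - by move=> k kN; exact: (run_grad run).
  - by move=> k kN; exact: (run_decrease run).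
  - by move=> k kN; exact: (run_update run).
  - by rewrite (run_x0 run).
apply: (@le_trans _ _ (P (~` bad))); last first.
  by apply: le_measure; rewrite ?inE//; exact: measurableC.
by rewrite probability_setC// EFinB leeB.
Qed.
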